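(* Let $d\ge 1$, $1\le p_k\le q_k<\infty$, $\alpha\in\mathbb R^d$, and $$\beta_k=1-\frac1{p_k}-\frac1{q_k}-\alpha_k,\qquad k=1,\dots,d.$$ Let $g:(0,\infty)^d\to\mathbb R$ be one of the following: (i) $g(x)=g_w(x)=\int_{\prod_k[x_k,\infty)}w(t)\,dt$, where $w\ge0$ is a nonzero (i.e. not almost everywhere zero), integrable, compactly supported function on $(0,\infty)^d$ (support taken in $[0,\infty)^d$); (ii) $d\ge2$ and $g(x)=\mathbf 1_{\{0<x_k\le b_k\,\forall k\}}(x)-c\,\mathbf 1_{\{0<x_k\le a_k\,\forall k\}}(x)$, where $a,b\in(0,\infty)^d$, $a_k<b_k$ for every $k$, and $0<c<1$; (iii) $d\ge2$ and $g(x)=\mu\big(\prod_k[x_k,\infty)\big)$ with $\mu=\nu_b-c\,\nu_a$, where $0<c<1$, $\varepsilon>0$, $a,b\in(0,\infty)^d$ with $b_k-a_k>\varepsilon$ for every $k$, $\phi(z)=\prod_{k=1}^d\phi_k(z_k)$ is nonzero with $\phi_k\in C_c^\infty((0,\varepsilon))$, $\phi_k\ge0$, and $\nu_v$ denotes the measure with density $\phi(t-v)$ (extended by zero outside $v+(0,\varepsilon)^d$). Let $f$ be the coordinatewise even extension of $g$ to $\mathbb R^d$. Then the two norms $\|\Pi_\alpha\widehat f_A\|_{L_{\vec q}(\mathbb R^d)}$ and $\|\Pi_\beta f\|_{L_{\vec p}(\mathbb R^d)}$ are both finite if and only if $$-\frac1{q_k}<\alpha_k<1-\frac1{q_k},\qquad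 k=1,\dots,d.$$ At the lower endpoint ($\alpha_k=-1/q_k$ for some $k$) the Fourier-side norm $\|\Pi_\alpha\widehat f_A\|_{L_{\vec q}(\mathbb R^d)}$ is infinite, while at the upper endpoint ($\alpha_k=1-1/q_k$ for some $k$) the spatial weighted norm $\|\Pi_\beta f\|_{L_{\vec p}(\mathbb R^d)}$ is infinite.
   Context: Even extension. $f(x)=g(|x_1|,\dots,|x_d|)$ when $x_1\cdots x_d\ne0$; the values on the coordinate hyperplanes are arbitrary measurable values (or the continuous boundary values when $g$ extends continuously to the closed orthant); this is irrelevant almost everywhere. Abel Fourier transform. For $\varepsilon\in(0,\infty)^d$ put $\widehat f_\varepsilon(\xi)=\int_{\mathbb R^d}f(x)e^{-\sum_k\varepsilon_k|x_k|}e^{ix\cdot\xi}\,dx$. For $\xi$ with no zero coordinate, $\widehat f_A(\xi)=\lim_{\varepsilon\to0+}\widehat f_\varepsilon(\xi)$, where all $\varepsilon_k\downarrow0$ along an arbitrary path (the limit being independent of the path); if some $\xi_k=0$, set $\widehat f_A(\xi)=0$. If $f\in L^1(\mathbb R^d)$, then $\widehat f_A$ equals the ordinary Fourier transform $\widehat f(\xi)=\int e^{ix\cdot\xi}f(x)\,dx$ almost everywhere. Weights and mixed norms. For $\rho\in\mathbb R^d$, $\Pi_\rho(x)=\prod_k|x_k|^{\rho_k}$ if $x_1\cdots x_d\neq0$, and $\Pi_\rho(x)=0$ on the coordinate hyperplanes. For $\vec s=(s_1,\dots,s_d)$ with $1\le s_k<\infty$, $$\|F\|_{L_{\vec s}(\mathbb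 R^d)}=\left(\int_{\mathbb R}\cdots\left(\int_{\mathbb R}|F(x_1,\dots,x_d)|^{s_1}\,dx_1\right)^{s_2/s_1}\cdots dx_d\right)^{1/s_d}$$ (the $x_1$ integral is innermost, $x_d$ outermost). *)

(* Defs.v *)
From HB Require Import structures.
From mathcomp Require Import all_boot all_order all_algebra.
From mathcomp Require Import complex.
From mathcomp Require Import all_classical all_reals all_analysis.

Set Implicit Arguments.
Unset Strict Implicit.
Unset Printing Implicit Defensive.
Import Order.TTheory GRing.Theory Num.Theory.
Import numFieldNormedType.Exports.
Local Open Scope classical_set_scope.
Local Open Scope ring_scope.

Section PowerMeasureStep.
Context {disp : measure_display} {T : measurableType disp} {R : realType}.

Definition tcons n (z : T * n.-tuple T) : n.+1.-tuple T := cons_tuple z.1 z.2.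

Lemma measurable_tcons n : measurable_fun setT (@tcons n).
Proof. exact: measurable_cons. Qed.

Variables (m : {sigma_finite_measure set T -> \bar R}) (n : nat)
  (mu : {sigma_finite_measure set n.-tuple T -> \bar R}).

Definition cons_measure : set (n.+1.-tuple T) -> \bar R :=
  pushforward (m \x mu)%E (@tcons n).

Let cons_measure0 : cons_measure set0 = 0%E.
Proof. by rewrite /cons_measure /pushforward preimage_set0 measure0. Qed.

Let cons_measure_ge0 A : (0 <= cons_measure A)%E.
Proof. by rewrite /cons_measure /pushforward; exact: measure_ge0. Qed.

Let cons_measure_sigma_additive : semi_sigma_additive cons_measure.
Proof.
move=> F mF tF mUF; rewrite /cons_measure /pushforward preimage_bigcup.
have mf (A : set (n.+1.-tuple T)) :
    measurable A -> measurable (@tcons n @^-1` A).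
  by move=> mA; rewrite -[X in measurable X]setTI; exact: measurable_tcons.
apply: measure_semi_sigma_additive.
- by move=> k; exact: mf.
- apply/trivIsetP => /= i j _ _ ij; rewrite -preimage_setI.
  by move/trivIsetP : tF => /(_ _ _ _ _ ij) ->//; rewrite preimage_set0.
- by rewrite -preimage_bigcup; exact: mf.
Qed.

HB.instance Definition _ := isMeasure.Build _ _ _ cons_measure
  cons_measure0 cons_measure_ge0 cons_measure_sigma_additive.

Let cons_measure_sigma_finite : sigma_finite setT cons_measure.
Proof.
have /sigma_finiteP[F [FT ndF Foo]] := sigma_finiteT m.
have /sigma_finiteP[G [GT ndG Goo]] := sigma_finiteT mu.
pose u (t : n.+1.-tuple T) : T * n.-tuple T := (thead t, [tuple of behead t]).
have Ku z : u (@tcons n z) = z.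
  by case: z => x t; congr pair; apply: val_inj => //=; case: t.
have measurable_u : measurable_fun setT u.
  apply/measurable_fun_pairP; split.
    exact: (measurable_tnth ord0).
  exact: measurable_behead.
exists (fun i => u @^-1` (F i `*` G i)).
  rewrite -preimage_bigcup -[LHS](preimage_setT u); congr (_ @^-1` _).
  rewrite -setXTT FT GT predeqE => -[x y]; split.
    move=> [/= [i _ Fix] [k _ Gky]]; exists (maxn i k) => //; split.
    - by move: x Fix; exact/subsetPset/ndF/leq_maxl.
    - by move: y Gky; exact/subsetPset/ndG/leq_maxr.
  by move=> [i _ []/= ? ?]; split; exists i.
move=> i; have [? ?] := Foo i; have [? ?] := Goo i; split.
  by rewrite -[X in measurable X]setTI; apply: measurable_u => //; exact: measurableX.
rewrite /cons_measure /pushforward (_ : _ @^-1` _ = F i `*` G i); last first.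
  by apply/seteqP; split=> z; rewrite /preimage/mkset Ku.
by rewrite product_measure1E// lte_mul_pinfty// ge0_fin_numE.
Qed.

HB.instance Definition _ :=
  Measure_isSigmaFinite.Build _ _ _ cons_measure cons_measure_sigma_finite.

End PowerMeasureStep.

Section PowerMeasure.
Context {disp : measure_display} {T : measurableType disp} {R : realType}.
Variable m : {sigma_finite_measure set T -> \bar R}.

(* Product measure on tuples: the head is independent of the tail; see
   [power_measure_box] for the value on boxes. *)
Fixpoint power_measure n : {sigma_finite_measure set n.-tuple T -> \bar R} :=
  match n with
  | 0 => [the {sigma_finite_measure set 0.-tuple T -> \bar R} of
            \d_([tuple] : 0.-tuple T)]
  | n'.+1 => [the {sigma_finite_measure set n'.+1.-tuple T -> \bar R} of
            cons_measure m (power_measure n')]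
  end.

Lemma power_measure_box n (A : 'I_n -> set T) : (forall i, measurable (A i)) ->
  power_measure n [set t | forall i, A i (tnth t i)] = (\prod_(i < n) m (A i))%E.
Proof.
elim: n A => [|n IHn] A mA.
  rewrite big_ord0 /= diracE mem_set//= => -[].
  by [].
rewrite big_ord_recl -IHn//= /cons_measure /pushforward.
rewrite -product_measure1E//; last first.
  rewrite (_ : [set _ | _] = \bigcap_(i in [set: 'I_n])
    ((fun t : n.-tuple T => tnth t i) @^-1` A (lift ord0 i))); last first.
    by apply/seteqP; split => t /= tA i; [move=> _; exact: tA|exact: (tA i I)].
  apply: fin_bigcap_measurable => // i _.
  by rewrite -[X in measurable X]setTI; exact: (measurable_tnth i).
congr (_ _); apply/seteqP; split => -[x t] /=.
  move=> xtA; split=> [|i]; first exact: (xtA ord0).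
  by have := xtA (lift ord0 i); rewrite tnthS.
move=> [Ax tA] i; case: (unliftP ord0 i) => [j|] ->//.
by rewrite tnthS.
Qed.

End PowerMeasure.

(* [lebesgue_measure] lives on [measurableTypeR R], which is [R] with its Borel
   sigma-algebra; tuples carry the product sigma-algebra. *)
Notation Rtuple R d := (d.-tuple (measurableTypeR R)).

Section EuclideanSpace.
Variables (R : realType) (d : nat).

Definition lebesgue_tuple : {sigma_finite_measure set Rtuple R d -> \bar R} :=
  power_measure (@lebesgue_measure R) d.

Definition no_zero_coord (x : Rtuple R d) := forall k, tnth x k != 0.

(* A function g on (0,oo)^d is represented by a function on all tuples whose
   values outside [orthant] are never used. *)
Definition orthant : set (Rtuple R d) := [set x | forall k, 0 < tnth x k].

Definition upper_quadrant (x : Rtuple R d) : set (Rtuple R d) :=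
  [set t | forall k, tnth x k <= tnth t k].

Definition lower_box (b : Rtuple R d) : set (Rtuple R d) :=
  [set x | forall k, 0 < tnth x k <= tnth b k].

(* The values of f on the coordinate hyperplanes are left free, up to Borel
   measurability of f. *)
Definition even_extension (g f : Rtuple R d -> R) :=
  measurable_fun setT f /\
  forall x, no_zero_coord x -> f x = g [tuple `|tnth x k| | k < d].

Definition Cintegral (F : Rtuple R d -> R[i]) : R[i] :=
  (\int[lebesgue_tuple]_x complex.Re (F x)
     +i* \int[lebesgue_tuple]_x complex.Im (F x))%C.

Definition expi (theta : R) : R[i] := (cos theta +i* sin theta)%C.

(* [R[i]^o] is R[i] with the topology of its norm. *)
Definition damped_fourier (f : Rtuple R d -> R) (eps : 'rV[R]_d)
    (xi : Rtuple R d) : R[i]^o :=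
  Cintegral (fun x =>
    (f x * expR (- \sum_k eps ord0 k * `|tnth x k|))%:C%C
    * expi (\sum_k tnth x k * tnth xi k)).

(* eps -> 0 with every coordinate positive: convergence along this filter is
   convergence along every path with the same limit. *)
Definition abel_filter : set_system 'rV[R]_d :=
  within [set eps : 'rV[R]_d | forall k, 0 < eps ord0 k] (nbhs (0 : 'rV[R]_d)).

Definition abel_fourier (f : Rtuple R d -> R) (xi : Rtuple R d) : R[i] :=
  if [forall k, tnth xi k != 0]
  then lim (damped_fourier f eps xi @[eps --> abel_filter])
  else 0.

Definition weight (rho : 'I_d -> R) (x : Rtuple R d) : R :=
  if [forall k, tnth x k != 0] then \prod_k `|tnth x k| `^ rho k else 0.

(* The closure is taken in R^d, so that the support may meet the boundary of
   [0,oo)^d; row vectors carry the topology of R^d. *)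
Definition compactly_supported (w : Rtuple R d -> R) :=
  compact (closure
    [set \row_k tnth t k | t in [set t | orthant t /\ w t != 0]]
      : set 'rV[R]_d).

Definition tail_integral (w : Rtuple R d -> R) (x : Rtuple R d) : R :=
  \int[lebesgue_tuple]_(t in upper_quadrant x) w t.

Definition is_tail_integral (g : Rtuple R d -> R) :=
  exists w : Rtuple R d -> R,
    [/\ forall t, orthant t -> 0 <= w t,
        ~ {ae lebesgue_tuple, forall t, orthant t -> w t = 0},
        lebesgue_tuple.-integrable orthant (EFin \o w),
        compactly_supported w &
        forall x, orthant x -> g x = tail_integral w x].

Definition is_box_difference (g : Rtuple R d -> R) :=
  (2 <= d)%N /\
  exists (a b : Rtuple R d) (c : R),
    [/\ orthant a, orthant b, forall k, tnth a k < tnth b k, 0 < c < 1 &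
        forall x, orthant x ->
          g x = \1_(lower_box b) x - c * \1_(lower_box a) x].

Definition smooth (h : R -> R) :=
  forall (n : nat) (z : R), derivable (derive1n n h) z 1.

(* An element of C_c^oo(U), identified with its extension by zero to R. *)
Definition test_function (U : set R) (h : R -> R) :=
  [/\ smooth h, compact (closure [set z | h z != 0]) &
      closure [set z | h z != 0] `<=` U].

Definition translated_density (phi : 'I_d -> R -> R) (v t : Rtuple R d) : R :=
  \prod_k phi k (tnth t k - tnth v k).

Definition translated_measure (phi : 'I_d -> R -> R) (v : Rtuple R d)
    (A : set (Rtuple R d)) : \bar R :=
  \int[lebesgue_tuple]_(t in A) (translated_density phi v t)%:E.

Definition is_smooth_difference (g : Rtuple R d -> R) :=
  (2 <= d)%N /\
  exists (a b : Rtuple R d) (c eps : R) (phi : 'I_d -> R -> R),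
    let mu A :=
      (translated_measure phi b A - c%:E * translated_measure phi a A)%E in
    [/\ 0 < c < 1 /\ 0 < eps,
        [/\ orthant a, orthant b & forall k, eps < tnth b k - tnth a k],
        forall k, test_function `]0, eps[ (phi k) /\ forall z, 0 <= phi k z,
        exists z : Rtuple R d, \prod_k phi k (tnth z k) != 0 &
        forall x, orthant x -> g x = fine (mu (upper_quadrant x))].

End EuclideanSpace.

(* Component 0 is innermost: the L^{s_0} norm in the first variable is the new
   integrand, so that it enters the next integral with exponent s_1 / s_0. *)
Fixpoint mixed_norm (R : realType) (d : nat) :
    ('I_d -> R) -> (Rtuple R d -> \bar R) -> \bar R :=
  match d with
  | 0 => fun _ F => `|F [tuple]|%E
  | n.+1 => fun s F =>
      mixed_norm (fun k => s (lift ord0 k))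
        (fun t => Lnorm (@lebesgue_measure R) (s ord0)%:E
                    (fun x => F (tcons (x, t))))
  end.

Section Norms.
Variables (R : realType) (d : nat).

(* In R[i] the norm `|z| is itself a complex number, with null imaginary part. *)
Definition fourier_norm (alpha q : 'I_d -> R) (f : Rtuple R d -> R) : \bar R :=
  mixed_norm q
    (fun xi => (weight alpha xi * complex.Re `|abel_fourier f xi|)%:E).

Definition spatial_norm (beta p : 'I_d -> R) (f : Rtuple R d -> R) : \bar R :=
  mixed_norm p (fun x => (weight beta x * f x)%:E).

End Norms.

(* Main.v *)
Require Import Defs.
From HB Require Import structures.
From mathcomp Require Import all_boot all_order all_algebra.
From mathcomp Require Import complex.
From mathcomp Require Import all_classical all_reals all_analysis.
From mathcomp Require Import measurable_realfun ring lra.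

Set Implicit Arguments.
Unset Strict Implicit.
Unset Printing Implicit Defensive.
Import Order.TTheory GRing.Theory Num.Theory.
Import numFieldNormedType.Exports.
Local Open Scope classical_set_scope.
Local Open Scope ring_scope.

(** Off the coordinate hyperplanes, which are negligible, f is in each of the three
   families nonnegative, bounded and of bounded support, and it is bounded below
   by a positive constant near the origin. Everything follows from comparing f
   and its transform, pointwise, with products of functions of one variable, for
   which a mixed norm is the product of the one-variable norms
   ([mixed_norm_prod]).

   The support being bounded, the damping factor tends to 1 uniformly on it, so
   the Abel transform of f is its ordinary transform ([abel_fourierE]).

   Upper bounds. The function f is a superposition of indicators of symmetric
   boxes: f(x) is the mass that a signed measure mu gives to the points t with
   |x_k| <= t_k for all k, where mu has an integrable density or is a
   combination of two point masses. The transform of the box with half-sides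
   t_k is the product of the 2 sin(t_k xi_k) / xi_k ([integral_symbox_cos]);
   integrating in t, by Fubini when mu has a density ([tail_fourier_le]), shows
   that the transform of f is at most a constant times the product of the
   max(1, |xi_k|)^-1. After multiplication by the weight, each factor
   |xi|^alpha_k max(1, |xi|)^-1 has a finite L^q_k norm when
   -1/q_k < alpha_k < 1 - 1/q_k ([Lnorm_tempered_power_lty]). On the spatial
   side f is dominated by a multiple of the indicator of a box, and |x|^beta_k
   is locally in L^p_k when beta_k > -1/p_k, that is, when alpha_k < 1 - 1/q_k.

   Lower bounds. For the two differences, nonnegativity holds because the mass
   placed around b lies further out than the mass placed around a: a quadrant
   t >= x holds at least as much of the former as of the latter, and c < 1. Since
   f is nonnegative with positive integral, its transform, like f itself, stays
   above a positive constant near the origin ([profile_fourier_near0]). Hence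
   both norms dominate products of the norms of powers |x|^a on an interval
   (0, r]. Such a norm is positive, and it is infinite as soon as a times the
   exponent is at most -1 ([mixed_norm_infty]). This gives the necessity of the
   two strict inequalities, and the infinite norms at the endpoints. *)

(** * Mixed norms *)

Section MixedNorm.
Variable R : realType.
Local Notation leb := (@lebesgue_measure R).

(** The integral of a nonnegative function is a supremum over the simple
   functions below it, hence monotone for arbitrary functions; mixed norms can
   then be compared pointwise with explicit ones. *)
Lemma ge0_le_integralT d (T : measurableType d) (m : {measure set T -> \bar R})
    (f g : T -> \bar R) :
  (forall x, 0 <= f x)%E -> (forall x, f x <= g x)%E ->
  (\int[m]_x f x <= \int[m]_x g x)%E.
Proof.
move=> f0 fg; rewrite !ge0_integralTE//; last first.
  by move=> x; exact: le_trans (f0 x) (fg x).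
apply: le_ereal_sup => _ [h /= hf <-]; exists h => // x.
exact: le_trans (hf x) (fg x).
Qed.

Lemma le_Lnorm d (T : measurableType d) (m : {measure set T -> \bar R}) (s : R)
    (F G : T -> \bar R) : 0 < s ->
  (forall x, `|F x| <= `|G x|)%E -> (Lnorm m s%:E F <= Lnorm m s%:E G)%E.
Proof.
move=> s0 FG; rewrite unlock.
have pw r (x y : \bar R) : 0 <= r -> (0 <= x)%E -> (x <= y)%E ->
    (x `^ r <= y `^ r)%E.
  move=> r0 x0 xy; have y0 := le_trans x0 xy.
  by apply: gt0_ler_poweR => //; rewrite in_itv/= leey andbT.
apply: (pw); first by rewrite invr_ge0 ltW.
  by apply: integral_ge0 => x _; exact: poweR_ge0.
apply: ge0_le_integralT => x; first exact: poweR_ge0.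
by apply: pw => //; exact: ltW.
Qed.

Lemma ge0_mule_Lnorm d (T : measurableType d) (m : {measure set T -> \bar R})
    (s : R) (c : \bar R) (h : T -> \bar R) :
  0 < s -> (0 <= c)%E -> measurable_fun setT h ->
  Lnorm m s%:E (fun x => c * h x)%E = (c * Lnorm m s%:E h)%E.
Proof.
move=> s0 c0 mh; rewrite unlock.
under eq_integral do rewrite abseM gee0_abs// poweRM//.
rewrite ge0_integralZl//; last 3 first.
- by apply: (measurableT_comp (measurable_poweR s)); exact: measurableT_comp.
- by move=> x _; exact: poweR_ge0.
- exact: poweR_ge0.
rewrite poweRM ?poweR_ge0//; last first.
  by apply: integral_ge0 => x _; exact: poweR_ge0.
by rewrite -poweRrM mulfV ?gt_eqF// poweRe1.
Qed.

Lemma le_mixed_norm d (s : 'I_d -> R) (F G : Rtuple R d -> \bar R) :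
  (forall k, 0 < s k) -> (forall x, `|F x| <= `|G x|)%E ->
  (mixed_norm s F <= mixed_norm s G)%E.
Proof.
elim: d s F G => [|d IH] s F G s0 FG /=; first exact: FG.
apply: IH => // t; rewrite !gee0_abs ?Lnorm_ge0//.
exact: le_Lnorm.
Qed.

(** The constant c ranges over the extended reals because, one variable at a
   time, it absorbs the norms of the inner factors, which may be infinite. *)
Lemma mixed_norm_prod d (s : 'I_d -> R) (h : 'I_d -> measurableTypeR R -> R)
    (c : \bar R) :
  (forall k, 0 < s k) -> (0 <= c)%E ->
  (forall k x, 0 <= h k x) -> (forall k, measurable_fun setT (h k)) ->
  mixed_norm s (fun x => c * (\prod_k h k (tnth x k))%:E)%E =
  (c * \prod_k Lnorm leb (s k)%:E (EFin \o h k))%E.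
Proof.
elim: d s h c => [|d IH] s h c s0 c0 h0 mh.
  by rewrite /= !big_ord0 !mule1 gee0_abs.
rewrite /= big_ord_recl muleA.
rewrite -(IH (fun k => s (lift ord0 k)) (fun k => h (lift ord0 k)))//; last first.
  by rewrite mule_ge0// Lnorm_ge0.
congr mixed_norm; apply/funext => t.
set P := \prod_k h _ _.
have -> : (fun x => c * (\prod_k h k (tnth (tcons (x, t)) k))%:E)%E =
          (fun x => (c * P%:E) * (EFin \o h ord0) x)%E.
  apply/funext => x; rewrite big_ord_recl /=.
  have -> : tnth (tcons (x, t)) ord0 = x by [].
  rewrite EFinM muleCA muleA [RHS]muleC muleA; congr (_ * _ * _%:E)%E.
  by apply: eq_bigr => k _; rewrite /tcons /= tnthS.
rewrite ge0_mule_Lnorm//; first by rewrite muleAC.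
  by rewrite mule_ge0// lee_fin prodr_ge0.
by apply/measurable_EFinP; exact: mh.
Qed.

End MixedNorm.

(** * Norms of powers on the line *)

Section PowerNorms.
Variable R : realType.
Local Notation leb := (@lebesgue_measure R).

Lemma FTC_gt0 (f F : R -> R) (u v : R) : 0 < u -> u < v ->
  (forall x : R, 0 < x -> is_derive x 1 F (f x)) ->
  (forall x : R, 0 < x -> {for x, continuous f}) ->
  (\int[leb]_(x in `[u, v]) (f x)%:E = (F v - F u)%:E)%E.
Proof.
move=> u0 uv dF cf.
have cF x : 0 < x -> {for x, continuous F}.
  move=> x0; apply: differentiable_continuous; apply/derivable1_diffP.
  exact: (@ex_derive _ _ _ _ _ _ _ (dF x x0)).
rewrite (@continuous_FTC2 _ f F)//.
- apply: continuous_in_subspaceT => x; rewrite inE/= in_itv/= => /andP[ux _].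
  by apply: cf; exact: lt_le_trans ux.
- split.
  + move=> x; rewrite in_itv/= => /andP[ux _].
    exact: (@ex_derive _ _ _ _ _ _ _ (dF x (lt_trans u0 ux))).
  + by apply: cvg_at_right_filter; exact: cF.
  + by apply: cvg_at_left_filter; apply: cF; exact: lt_trans uv.
- move=> x; rewrite in_itv/= => /andP[ux _].
  by rewrite derive1E; apply: derive_val; exact: dF (lt_trans u0 ux).
Qed.

Lemma continuous_powR_gt0 (a x : R) :
  0 < x -> {for x, continuous (fun y : R => y `^ a)}.
Proof.
move=> x0; apply: differentiable_continuous; apply/derivable1_diffP.
by apply: derivable_powR; rewrite in_itv/= x0.
Qed.

Lemma integral_powR (a u v : R) : a + 1 != 0 -> 0 < u -> u < v ->
  (\int[leb]_(x in `[u, v]) (x `^ a)%:E =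
   ((v `^ (a + 1) - u `^ (a + 1)) / (a + 1))%:E)%E.
Proof.
move=> a1 u0 uv.
have dF (x : R) : 0 < x ->
    is_derive x 1 (fun y : R => (a + 1)^-1 * y `^ (a + 1)) (x `^ a).
  move=> x0; have := @is_deriveZ _ _ _ (fun y : R => y `^ (a + 1)) (a + 1)^-1
    x 1 _ (is_derive1_powR (a + 1) x0).
  by rewrite /GRing.scale/= mulrA mulVf// mul1r addrK.
have -> := FTC_gt0 u0 uv dF (fun x => @continuous_powR_gt0 a x).
by rewrite -mulrBr mulrC.
Qed.

Lemma integral_powRN1 (u v : R) : 0 < u -> u < v ->
  (\int[leb]_(x in `[u, v]) (x `^ (-1))%:E = (ln v - ln u)%:E)%E.
Proof.
move=> u0 uv; apply: FTC_gt0 => //; last by move=> x; exact: continuous_powR_gt0.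
by move=> x x0; rewrite powRN powRr1 ?ltW//; exact: is_derive1_ln.
Qed.

(** Monotone convergence along the sets of points whose distance to the origin
   lies between 1/(n+2) and n+2; by symmetry the two halves of such a set carry
   the same integral. *)
Lemma ge0_integral_even_lty (H : R -> R) (C : R) :
  measurable_fun [set: R] (fun x : R => H `|x|) ->
  (forall x, 0 <= H x) -> (forall x : R, 0 < x -> {for x, continuous H}) ->
  (forall n : nat,
    (\int[leb]_(x in `[(n.+2%:R^-1)%R, (n.+2%:R : R)%R]) (H x)%:E <= C%:E)%E) ->
  (\int[leb]_x (H `|x : R|)%:E < +oo)%E.
Proof.
move=> mH H0 cH HC.
pose A (n : nat) : set R := `[n.+2%:R^-1, n.+2%:R]%classic.
pose B (n : nat) : set R := `[- n.+2%:R, - n.+2%:R^-1]%classic.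
pose F n := A n `|` B n.
have n0 n : 0 < n.+2%:R :> R by rewrite ltr0n.
have ni n : n.+2%:R^-1 < n.+2%:R :> R.
  by rewrite (@lt_trans _ _ 1)// ?invf_lt1 ?ltr1n.
have Feq : \bigcup_n F n = [set: R] `\ 0.
  apply/seteqP; split => x.
    move=> [n _ [|]]; rewrite /A /B /= in_itv/= => /andP[h1 h2]; split => // x0.
      by move: h1; rewrite x0 leNgt invr_gt0 n0.
    by move: h2; rewrite x0 oppr_ge0 leNgt invr_gt0 n0.
  move=> [_ /eqP x0].
  have nx : 0 < `|x| by rewrite normr_gt0.
  pose n := Num.truncn (Num.max `|x| `|x|^-1).
  have xn : Num.max `|x| `|x|^-1 <= n.+2%:R.
    apply: ltW; apply: lt_le_trans (truncnS_gt _) _.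
    by rewrite ler_nat.
  move: xn; rewrite ge_max => /andP[xn].
  rewrite -[X in _ <= X]invrK lef_pV2 ?posrE ?invr_gt0// => nix.
  exists n => //; have [xp|xp] := leP 0 x.
    by left; rewrite /A/= in_itv/=; move: xn nix; rewrite ger0_norm// => -> ->.
  right; rewrite /B/= in_itv/=; move: xn nix; rewrite ltr0_norm// => xn nix.
  by rewrite lerNl xn lerNr nix.
have mF n : measurable (F n) by apply: measurableU; exact: measurable_itv.
have ndF : nondecreasing_seq F.
  move=> m n mn; rewrite subsetEset => x.
  have mn1 : m.+2%:R <= n.+2%:R :> R by rewrite ler_nat.
  have mn2 : n.+2%:R^-1 <= m.+2%:R^-1 :> R by rewrite lef_pV2 ?posrE.
  move=> [|]; rewrite /A/B/= in_itv/= => /andP[h1 h2].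
    left; rewrite /A/= in_itv/=; apply/andP.
    by split; [exact: le_trans h1|exact: le_trans mn1].
  right; rewrite /B/= in_itv/=; apply/andP; split.
    by apply: le_trans h1; rewrite lerN2.
  by apply: le_trans h2 _; rewrite lerN2.
have mG (D : set R) : measurable_fun D (fun x => (H `|x|)%:E).
  by apply: measurable_funTS; apply/measurable_EFinP; exact: mH.
have FC n : (\int[leb]_(x in F n) (H `|x|)%:E <= (C + C)%:E)%E.
  rewrite ge0_integral_setU//; last 5 first.
  - exact: measurable_itv.
  - exact: measurable_itv.
  - exact: mG.
  - by move=> x _; rewrite lee_fin.
  - apply/disj_setPS => x [].
    rewrite /A/B/= !in_itv/= => /andP[h1 _] /andP[_ h2].
    have p : 0 < n.+2%:R^-1 :> R by rewrite invr_gt0.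
    by have := le_trans h1 h2; rewrite leNgt (lt_trans _ p)// oppr_lt0.
  rewrite EFinD; apply: leeD.
    apply: le_trans (HC n); rewrite le_eqVlt; apply/orP; left; apply/eqP.
    apply: eq_integral => x; rewrite inE /A/= in_itv/= => /andP[h1 _].
    by rewrite ger0_norm// (le_trans _ h1)// invr_ge0 ltW.
  rewrite /B (integration_by_substitution_oppr (G := fun x => H `|x|)).
  - apply: le_trans (HC n); rewrite le_eqVlt; apply/orP; left; apply/eqP.
    apply: eq_integral => x; rewrite inE /A/= in_itv/= => /andP[h1 _].
    by rewrite normrN ger0_norm// (le_trans _ h1)// invr_ge0 ltW.
  - exact: ltW.
  - apply: continuous_in_subspaceT => x; rewrite inE/= in_itv/= => /andP[_ h2].
    have x0 : 0 < `|x|.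
      by rewrite normr_gt0 lt_eqF// (le_lt_trans h2)// oppr_lt0 invr_gt0.
    apply: (@continuous_comp _ _ _ (fun y : R => `|y|) H).
      exact: norm_continuous.
    exact: cH.
have cvgF : (\int[leb]_(x in F i) (H `|x|)%:E @[i --> \oo] -->
    \int[leb]_(x in \bigcup_i F i) (H `|x|)%:E)%E.
  apply: (@ge0_nondecreasing_set_cvg_integral _ (measurableTypeR R) R F) => //.
    by move=> i; exact: mG.
  by move=> i x _; rewrite lee_fin.
rewrite -(@integral_setD1 _ _ 0)//; last exact: measurableD.
rewrite -Feq -(cvg_lim _ cvgF)//.
apply: le_lt_trans (ltry (C + C)).
apply: lime_le; first by apply/cvg_ex; eexists; exact: cvgF.
by near=> n; exact: FC.
Unshelve. all: by end_near. Qed.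

(** The model function of both upper bounds: the power a at the origin, the
   power a - b at infinity. *)
Definition tempered_power (a b x : R) : R :=
  `|x| `^ a * (Num.max 1 `|x|) `^ (- b).

Lemma measurable_tempered_power a b : measurable_fun setT (tempered_power a b).
Proof.
apply: measurable_funM.
  by apply: (measurableT_comp (measurable_powR _)); exact: normr_measurable.
apply: (measurableT_comp (measurable_powR _)).
by apply: measurable_maxr => //; exact: normr_measurable.
Qed.

Lemma Lnorm_tempered_power_lty (a b s : R) : 0 < s ->
  -1 < a * s -> (a - b) * s < -1 ->
  (Lnorm leb s%:E (EFin \o tempered_power a b) < +oo)%E.
Proof.
move=> s0 as1 abs1; rewrite unlock; apply: poweR_lty.
pose H (y : R) := y `^ (a * s) * (Num.max 1 y) `^ (- (b * s)).
have H0 y : 0 <= H y by rewrite /H mulr_ge0 ?powR_ge0.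
rewrite (eq_integral (fun x : measurableTypeR R => (H `|x : R|)%:E)); last first.
  move=> x _ /=; congr EFin.
  rewrite /tempered_power ger0_norm ?mulr_ge0 ?powR_ge0//.
  by rewrite powRM ?powR_ge0// -!powRrM mulNr.
pose c := (a - b) * s.
have a10 : 0 < a * s + 1 by rewrite -ltrBlDr sub0r.
have c10 : c + 1 < 0 by rewrite -ltrBrDr sub0r.
have HA (y : R) : y <= 1 -> H y = y `^ (a * s).
  by move=> y1; rewrite /H max_l// powR1 mulr1.
have HB (y : R) : 1 <= y -> H y = y `^ c.
  move=> y1; rewrite /H max_r// -powRD//.
    by congr (_ `^ _); rewrite /c mulrBl.
  by rewrite (gt_eqF (lt_le_trans ltr01 y1)) implybT.
have mH : measurable_fun [set: R] (fun x : R => H `|x|).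
  apply: measurable_funM.
    by apply: (measurableT_comp (measurable_powR _)); exact: normr_measurable.
  apply: (measurableT_comp (measurable_powR _)).
  by apply: measurable_maxr => //; exact: normr_measurable.
apply: (ge0_integral_even_lty (H := H) (C := (a * s + 1)^-1 + - (c + 1)^-1)) => //.
  move=> x x0; apply: (@continuousM _ _ (fun y : R => y `^ (a * s))
      (fun y => (Num.max 1 y) `^ (- (b * s)))).
    exact: continuous_powR_gt0.
  apply: (@continuous_comp _ _ _ (fun y : R => Num.max 1 y)
    (fun y : R => y `^ (- (b * s)))).
    by apply: continuous_max; [exact: cvg_cst|exact: cvg_id].
  by apply: continuous_powR_gt0; rewrite lt_max ltr01.
move=> n.
have n0 : 0 < n.+2%:R :> R by rewrite ltr0n.
have n1 : 1 < n.+2%:R :> R by rewrite ltr1n.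
have ni : n.+2%:R^-1 < 1 :> R by rewrite invf_lt1.
have mHD (D : set R) : measurable D -> measurable_fun D (fun x => (H x)%:E).
  move=> mD; apply: measurable_funTS; apply/measurable_EFinP.
  apply: measurable_funM; first exact: measurable_powR.
  by apply: (measurableT_comp (measurable_powR _)); exact: measurable_maxr.
have -> : `[(n.+2%:R^-1)%R, (n.+2%:R : R)%R]%classic =
    `[n.+2%:R^-1, 1]%classic `|` `]1, n.+2%:R]%classic.
  by rewrite -itv_bndbnd_setU// bnd_simp ltW.
rewrite ge0_integral_setU//; last 3 first.
- by apply: mHD; exact: measurableU.
- by move=> x _; rewrite lee_fin.
- apply/disj_setPS => x []; rewrite /= !in_itv/= => /andP[_ h1] /andP[h2 _].
  by move: (lt_le_trans h2 h1); rewrite ltxx.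
rewrite EFinD; apply: leeD.
  rewrite (eq_integral
    (fun x : measurableTypeR R => ((x : R) `^ (a * s))%:E)); last first.
    by move=> x; rewrite inE/= in_itv/= => /andP[_ h]; rewrite HA.
  rewrite integral_powR ?gt_eqF ?invr_gt0// lee_fin powR1.
  by rewrite ler_pdivrMr// mulVf ?gt_eqF// gerBl powR_ge0.
apply: (@le_trans _ _ (\int[leb]_(x in `[1%R, (n.+2%:R : R)%R]) (H x)%:E)%E).
  apply: ge0_subset_integral => //; first exact: mHD.
    by move=> x _; rewrite lee_fin.
  by apply: subset_itvr; rewrite bnd_simp.
rewrite (eq_integral (fun x : measurableTypeR R => ((x : R) `^ c)%:E)); last first.
  by move=> x; rewrite inE/= in_itv/= => /andP[h _]; rewrite HB.
rewrite integral_powR ?lt_eqF// lee_fin powR1.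
rewrite -mulrNN -invrN mulrC ler_pdivrMl ?oppr_gt0// mulfV ?oppr_eq0 ?lt_eqF//.
Qed.

Definition power_near0 (a r x : R) : R :=
  `|x| `^ a * \1_(`]0, r]%classic : set R) x.

Lemma measurable_power_near0 a r : measurable_fun setT (power_near0 a r).
Proof.
apply: measurable_funM.
  by apply: (measurableT_comp (measurable_powR _)); exact: normr_measurable.
by apply: measurable_indic; exact: measurable_itv.
Qed.

(** Factor x^(as) = x^(as+1) x^-1: a lower bound m of the first factor on [u, r]
   leaves the logarithmic integral of x^-1. Letting u tend to 0 gives divergence
   when as + 1 <= 0, and u = r/2 gives positivity in all cases. *)
Lemma integral_power_near0_ge (a r s u m : R) : 0 < s -> 0 < u -> u < r ->
  0 <= m -> (forall x, u <= x <= r -> m <= x `^ (a * s + 1)) ->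
  ((m * (ln r - ln u))%:E <= \int[leb]_x (`|(power_near0 a r x)%:E| `^ s))%E.
Proof.
move=> s0 u0 ur m0 mP.
rewrite EFinM -(integral_powRN1 u0 ur) -ge0_integralZl_EFin//; last 2 first.
- by move=> x _; rewrite lee_fin powR_ge0.
- by apply: measurable_funTS; apply/measurable_EFinP; exact: measurable_powR.
rewrite integral_mkcond; apply: ge0_le_integralT => x.
  by apply: erestrict_ge0 => y _; rewrite lee_fin mulr_ge0// powR_ge0.
rewrite patchE; case: ifPn => [|_]; last exact: poweR_ge0.
rewrite inE/= in_itv/= => /andP[ux xr].
have x0 : 0 < x := lt_le_trans u0 ux.
rewrite lee_fin /power_near0 indicE mem_set/= ?in_itv/= ?x0// mulr1.
rewrite (ger0_norm (powR_ge0 _ _)) (ger0_norm (ltW x0)) -powRrM.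
have -> : a * s = (a * s + 1) + (-1) by rewrite addrK.
rewrite [leRHS]powRD; last by rewrite (gt_eqF x0) implybT.
by apply: ler_wpM2r; rewrite ?powR_ge0// mP// ux.
Qed.

Lemma le_powR_neg (e x y : R) : e <= 0 -> 0 < x -> x <= y -> y `^ e <= x `^ e.
Proof.
move=> e0 x0 xy; rewrite -[e]opprK ![_ `^ (- - e)]powRN.
rewrite lef_pV2 ?posrE ?powR_gt0//; last exact: lt_le_trans xy.
by apply: ge0_ler_powR; rewrite ?nnegrE ?oppr_ge0// ltW// (lt_le_trans x0).
Qed.

Lemma Lnorm_power_near0_gt0 (a r s : R) : 0 < s -> 0 < r ->
  (0 < Lnorm leb s%:E (EFin \o power_near0 a r))%E.
Proof.
move=> s0 r0; rewrite unlock; apply: poweR_gt0.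
pose u := r / 2.
have u0 : 0 < u by rewrite divr_gt0.
have ur : u < r by rewrite /u; lra.
pose e := a * s + 1.
apply: lt_le_trans (integral_power_near0_ge (a := a) (r := r) (s := s) (u := u)
  (m := Num.min (u `^ e) (r `^ e)) s0 u0 ur _ _).
- rewrite lte_fin mulr_gt0// ?lt_min ?powR_gt0//.
  by rewrite subr_gt0 ltr_ln ?posrE.
- by rewrite le_min !powR_ge0.
- move=> x /andP[ux xr]; have x0 : 0 < x := lt_le_trans u0 ux.
  rewrite ge_min; have [e0|e0] := leP 0 e.
    by rewrite ge0_ler_powR ?nnegrE// ltW.
  by rewrite (le_powR_neg (ltW e0) x0 xr) orbT.
Qed.

Lemma Lnorm_power_near0_infty (a r s : R) : 0 < s -> 0 < r -> a * s <= -1 ->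
  Lnorm leb s%:E (EFin \o power_near0 a r) = +oo%E.
Proof.
move=> s0 r0 as1; rewrite unlock; apply/eqy_poweR; first by rewrite invr_gt0.
have e0 : a * s + 1 <= 0 by rewrite -lerBrDr sub0r.
set I := (\int[_]_ _ _)%E.
(* The cutoff u = r exp(-N) makes the logarithmic integral equal to N. *)
have key N : 0 < N -> ((r `^ (a * s + 1) * N)%:E <= I)%E.
  move=> N0; have u0 : 0 < r * expR (- N) by rewrite mulr_gt0 ?expR_gt0.
  have ur : r * expR (- N) < r by rewrite gtr_pMr// expR_lt1 oppr_lt0.
  rewrite [X in (_ * X)%:E](_ : N = ln r - ln (r * expR (- N))); last first.
    by rewrite lnM ?posrE ?expR_gt0// expRK opprD opprK addrA subrr add0r.
  apply: integral_power_near0_ge => //; first exact: powR_ge0.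
  by move=> x /andP[ux xr]; apply: le_powR_neg => //; exact: lt_le_trans ux.
have r1 : 0 < r `^ (a * s + 1) by exact: powR_gt0.
case E : I => [i|//|]; last by have := key 1 ltr01; rewrite E.
have N0 : 0 < (`|i| + 1) / r `^ (a * s + 1) by rewrite divr_gt0// ltr_wpDl.
have := key _ N0; rewrite E lee_fin mulrC divfK ?gt_eqF//.
by rewrite leNgt (le_lt_trans (ler_norm i))// ltrDl.
Qed.

End PowerNorms.

(** * Pointwise criteria for finite and infinite mixed norms *)

Section MixedNormBounds.
Variable R : realType.

Lemma prode_lty (I : finType) (F : I -> \bar R) :
  (forall k, 0 <= F k < +oo)%E -> (\prod_k F k < +oo)%E.
Proof.
move=> F0; suff /andP[] : (0 <= \prod_k F k < +oo)%E by [].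
elim/big_ind : _ => [|x y /andP[x0 xy] /andP[y0 yy]|k _].
- by rewrite lee_fin ler01 ltry.
- by rewrite mule_ge0//= lte_mul_pinfty// ge0_fin_numE.
- exact: F0.
Qed.

Lemma mixed_norm_lty d (s a b : 'I_d -> R) (C : R) (F : Rtuple R d -> \bar R) :
  (forall k, 0 < s k) -> 0 <= C ->
  (forall k, -1 < a k * s k) -> (forall k, (a k - b k) * s k < -1) ->
  (forall x, `|F x| <=
     (C * \prod_k tempered_power (a k) (b k) (tnth x k))%:E)%E ->
  (mixed_norm s F < +oo)%E.
Proof.
move=> s0 C0 as1 abs1 FC.
have t0 k (x : R) : 0 <= tempered_power (a k) (b k) x.
  by rewrite mulr_ge0 ?powR_ge0.
apply: (@le_lt_trans _ _ (mixed_norm s (fun x =>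
    C%:E * (\prod_k tempered_power (a k) (b k) (tnth x k))%:E)%E)).
  apply: le_mixed_norm => // x; apply: le_trans (FC x) _.
  by rewrite -EFinM lee_fin ler_norm.
rewrite (mixed_norm_prod (h := fun k => tempered_power (a k) (b k)))//; last first.
  by move=> k; exact: measurable_tempered_power.
apply: lte_mul_pinfty => //.
apply: prode_lty => k.
by rewrite Lnorm_ge0/= Lnorm_tempered_power_lty.
Qed.

(** A single infinite factor suffices, because the others are positive. *)
Lemma mixed_norm_infty d (s a : 'I_d -> R) (r delta : R)
    (F : Rtuple R d -> \bar R) :
  (forall k, 0 < s k) -> 0 < r -> 0 < delta ->
  (exists k, a k * s k <= -1) ->
  (forall x, (forall k, 0 < tnth x k <= r) ->
     ((delta * \prod_k `|tnth x k| `^ a k)%:E <= `|F x|)%E) ->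
  mixed_norm s F = +oo%E.
Proof.
move=> s0 r0 delta0 [k ask] FC.
have t0 i (x : R) : 0 <= power_near0 (a i) r x.
  by rewrite mulr_ge0 ?powR_ge0.
apply/eqP; rewrite -leye_eq.
apply: (@le_trans _ _ (mixed_norm s (fun x =>
    delta%:E * (\prod_k power_near0 (a k) r (tnth x k))%:E)%E)); last first.
  apply: le_mixed_norm => // x.
  have [xr|/existsNP[i /negP xi]] := pselect (forall i, 0 < tnth x i <= r).
    apply: le_trans (FC x xr).
    rewrite -EFinM abse_EFin lee_fin ger0_norm; last first.
      by rewrite mulr_ge0 ?prodr_ge0// ltW.
    rewrite ler_pM2l//; apply: ler_prod => i _; rewrite t0/=.
    by rewrite /power_near0 indicE mem_set ?mulr1//= in_itv/= xr.
  rewrite (bigD1 i)//= /power_near0 indicE memNset; last first.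
    by rewrite /= in_itv/=; exact/negP.
  by rewrite ?mulr0 mul0r mulr0 normr0 abse_ge0.
rewrite (mixed_norm_prod (h := fun k => power_near0 (a k) r))//; last 2 first.
- by rewrite lee_fin ltW.
- by move=> i; exact: measurable_power_near0.
rewrite (bigD1 k)//= Lnorm_power_near0_infty// gt0_mulye.
  by rewrite gt0_muley// lte_fin.
elim/big_ind : _ => [|x y|i _]; first by rewrite lte_fin.
  exact: mule_gt0.
exact: Lnorm_power_near0_gt0.
Qed.

End MixedNormBounds.

(** * Integration over tuples and the transform of a box *)

Section TupleIntegration.
Variable R : realType.
Local Notation leb := (@lebesgue_measure R).
Local Notation lam := (lebesgue_tuple R).

Lemma measurable_coordwise d (A : 'I_d -> set (measurableTypeR R)) :
  (forall k, measurable (A k)) ->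
  measurable [set x : Rtuple R d | forall k, A k (tnth x k)].
Proof.
move=> mA; rewrite (_ : [set _ | _] = \bigcap_(k in [set: 'I_d])
    ((fun x : Rtuple R d => tnth x k) @^-1` A k)); last first.
  by apply/seteqP; split => x /= xA => [k _|k]; [exact: xA|exact: (xA k I)].
apply: fin_bigcap_measurable => // k _.
by rewrite -[X in measurable X]setTI; exact: (measurable_tnth k).
Qed.

Lemma integral_tcons d (F : Rtuple R d.+1 -> \bar R) :
  (lam d.+1).-integrable setT F ->
  (\int[lam d.+1]_x F x = \int[leb]_x \int[lam d]_t F (tcons (x, t)))%E.
Proof.
move=> /integrableP[mF iF].
have mFc : measurable_fun setT (F \o @tcons _ (measurableTypeR R) d).
  by apply: measurableT_comp => //; exact: measurable_tcons.
have iFc : (leb \x lam d)%E.-integrable setT (F \o @tcons _ (measurableTypeR R) d).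
  apply/integrableP; split => //; apply: le_lt_trans iF.
  rewrite le_eqVlt; apply/orP; left; apply/eqP.
  rewrite [RHS](@ge0_integral_pushforward _ _ _ _ _ _ (@measurable_tcons _ _ d)
    (leb \x lam d)%E setT (fun x => `|F x|%E))//.
  exact: measurableT_comp.
rewrite [LHS](@integral_pushforward _ _ _ _ _ _ (@measurable_tcons _ _ d)
    (leb \x lam d)%E setT F)//.
by rewrite preimage_setT -(integral12_prod_meas1 iFc).
Qed.

Definition dot d (x : Rtuple R d) (xi : 'I_d -> R) : R := \sum_k tnth x k * xi k.

Lemma measurable_dot d (xi : 'I_d -> R) :
  measurable_fun setT (fun x : Rtuple R d => dot x xi).
Proof.
apply: measurable_sum => k; apply: measurable_funM => //.
exact: measurable_tnth.
Qed.

Lemma measurable_cos_dot d (theta : R) (xi : 'I_d -> R) :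
  measurable_fun setT (fun x : Rtuple R d => cos (theta + dot x xi)).
Proof.
apply: (@measurableT_comp _ _ _ _ _ _ (@cos R)).
  by apply: continuous_measurable_fun; exact: continuous_cos.
by apply: measurable_funD => //; exact: measurable_dot.
Qed.

Definition symbox d (t : 'I_d -> R) : set (Rtuple R d) :=
  [set x | forall k, `|tnth x k| <= t k].

Lemma symboxE d (t : 'I_d -> R) : symbox t =
  [set x | forall k, (`[- t k, t k]%classic : set (measurableTypeR R)) (tnth x k)].
Proof.
by apply/seteqP; split => x xt k; have := xt k; rewrite /= in_itv/= ler_norml.
Qed.

Lemma measurable_symbox d (t : 'I_d -> R) : measurable (symbox t).
Proof.
rewrite symboxE.
apply: (measurable_coordwise (A := fun k => `[- t k, t k]%classic)) => k.
exact: measurable_itv.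
Qed.

Lemma measure_symbox_lty d (t : 'I_d -> R) : (lam d (symbox t) < +oo)%E.
Proof.
rewrite symboxE.
rewrite (power_measure_box leb (A := fun k => `[- t k, t k]%classic)); last first.
  by move=> k; exact: measurable_itv.
apply: prode_lty => k; rewrite measure_ge0/=.
apply: (@le_lt_trans _ _ (leb (`[(- t k)%R, t k]%classic))) => //.
rewrite lebesgue_measure_itv/=.
by case: ifPn => // _; rewrite -EFinB ltry.
Qed.

Lemma integrable_symbox d (t : 'I_d -> R) (h : Rtuple R d -> R) (M : R) :
  measurable_fun setT h -> (forall x, `|h x| <= M) ->
  (forall x, ~ symbox t x -> h x = 0) ->
  (lam d).-integrable setT (EFin \o h).
Proof.
move=> mh hM h0.
have -> : EFin \o h = (EFin \o h) \_ (symbox t).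
  apply/funext => x; rewrite patchE; case: ifPn => //.
  by rewrite notin_setE => /h0 /= ->.
apply/(integrable_mkcond _ (measurable_symbox t)).
apply: measurable_bounded_integrable.
- exact: measurable_symbox.
- exact: measure_symbox_lty.
- exact: measurable_funTS.
- exists M; split; first exact: num_real.
  by move=> y My x _; exact: le_trans (hM x) (ltW My).
Qed.

Lemma integral_cos_itv (t theta xi c : R) : 0 < t -> xi != 0 ->
  (\int[leb]_(x in `[(- t)%R, t]) (cos (theta + x * xi) * c)%:E =
   (cos theta * (2 * sin (t * xi) / xi) * c)%:E)%E.
Proof.
move=> t0 xi0.
pose F (x : R) : R := sin (theta + x * xi) * (c / xi).
have dF (x : R) : is_derive x 1 F (cos (theta + x * xi) * c).
  have d1 : is_derive x 1 (fun y : R => theta + y * xi) xi.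
    have dM := @is_deriveM _ _ id (cst xi) x 1 _ _ (is_derive_id x 1)
      (is_derive_cst xi x 1).
    have dA := is_deriveD (is_derive_cst theta x 1) dM.
    by apply: is_derive_eq dA _; rewrite scaler0 !add0r /GRing.scale/= mulr1.
  have d2 := @is_derive1_comp _ sin (fun y : R => theta + y * xi) x _ _
    (is_derive_sin _) d1.
  have d3 := @is_deriveM _ _ _ (cst (c / xi)) x 1 _ _ d2 (is_derive_cst _ _ _).
  apply: is_derive_eq d3 _.
  rewrite scaler0 add0r /GRing.scale/=.
  by rewrite mulrC -mulrA; congr (_ * _); rewrite mulrC divfK.
have cF : continuous F.
  move=> x; apply: differentiable_continuous; apply/derivable1_diffP.
  exact: (@ex_derive _ _ _ _ _ _ _ (dF x)).
rewrite (@continuous_FTC2 _ (fun x => cos (theta + x * xi) * c) F).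
- rewrite -EFinB; congr EFin; rewrite /F -mulrBl mulNr sinB sinD.
  by field.
- lra.
- apply: continuous_subspaceT => x; apply: cvgMl.
  apply: (@continuous_comp _ _ _ (fun y : R => theta + y * xi) cos).
    by apply: cvgD; [exact: cvg_cst|apply: cvgMl; exact: cvg_id].
  exact: continuous_cos.
- split.
  + by move=> x _; exact: (@ex_derive _ _ _ _ _ _ _ (dF x)).
  + by apply: cvg_at_right_filter; exact: cF.
  + by apply: cvg_at_left_filter; exact: cF.
- by move=> x _; rewrite derive1E; apply: derive_val.
Qed.

Lemma normr_indic_le1 (U : Type) (A : set U) (x : U) : `|\1_A x : R| <= 1.
Proof. by rewrite indicE; case: (_ \in _); rewrite ?normr1 ?normr0. Qed.

Lemma integrable_symbox_cos d (t : 'I_d -> R) (xi : 'I_d -> R) (theta : R) :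
  (lam d).-integrable setT
    (fun x => (\1_(symbox t) x * cos (theta + dot x xi))%:E).
Proof.
apply: (@integrable_symbox _ t
  (fun x => \1_(symbox t) x * cos (theta + dot x xi)) 1).
- apply: measurable_funM; last exact: measurable_cos_dot.
  by apply: measurable_indic; exact: measurable_symbox.
- move=> x; rewrite normrM -[leRHS]mulr1.
  by apply: ler_pM => //; [exact: normr_indic_le1|exact: cos_max].
- by move=> x xt; rewrite indicE memNset// mul0r.
Qed.

(** The phase theta makes the induction on d go through: integrating out the
   last d coordinates leaves a cosine whose phase contains the first one. With
   theta = 0 and theta = - pi / 2 the formula gives the real and the imaginary
   part of the transform. *)
Lemma integral_symbox_cos d (t : 'I_d -> R) (xi : 'I_d -> R) (theta : R) :
  (forall k, 0 < t k) -> (forall k, xi k != 0) ->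
  (\int[lam d]_x (\1_(symbox t) x * cos (theta + dot x xi))%:E =
   (cos theta * \prod_k (2 * sin (t k * xi k) / xi k))%:E)%E.
Proof.
elim: d t xi theta => [|d IH] t xi theta t0 xi0.
  (* The measure on 0-tuples is the Dirac mass at the empty tuple. *)
  rewrite big_ord0 mulr1 [LHS](@integral_dirac _ _ _ R)//; last first.
    apply/measurable_EFinP; apply: measurable_funM; last exact: measurable_cos_dot.
    by apply: measurable_indic; exact: measurable_symbox.
  rewrite diracT mul1e indicE mem_set; last by case.
  by rewrite mul1r /dot big_ord0 addr0.
rewrite integral_tcons; last exact: integrable_symbox_cos.
pose t' k := t (lift ord0 k); pose xi' k := xi (lift ord0 k).
pose P := \prod_k (2 * sin (t' k * xi' k) / xi' k).
transitivity (\int[leb]_(x in `[(- t ord0)%R, t ord0])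
    (cos (theta + x * xi ord0) * P)%:E)%E; last first.
  rewrite integral_cos_itv// big_ord_recl; congr EFin.
  by rewrite -[LHS]mulrA.
rewrite [RHS]integral_mkcond; apply: eq_integral => x _.
have -> : (fun z : Rtuple R d => (\1_(symbox t) (tcons (x, z)) *
    cos (theta + dot (tcons (x, z)) xi))%:E) =
    (fun z => (if x \in `[- t ord0, t ord0] then
       \1_(symbox t') z * cos ((theta + x * xi ord0) + dot z xi') else 0)%:E).
  apply/funext => z; congr EFin.
  have -> : dot (tcons (x, z)) xi = x * xi ord0 + dot z xi'.
    rewrite /dot big_ord_recl; congr (_ + _).
    by apply: eq_bigr => k _; rewrite /tcons tnthS.
  rewrite addrA in_itv/= -ler_norml.
  have [xt|xt] := boolP (`|x| <= t ord0).
    congr (_ * _); rewrite !indicE; congr (_%:R); congr nat_of_bool.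
    apply/idP/idP; rewrite !inE => H k.
      by have := H (lift ord0 k); rewrite /tcons tnthS.
    case: (unliftP ord0 k) => [j|] ->//.
    by rewrite /tcons tnthS; exact: H.
  rewrite indicE memNset ?mul0r// => H.
  by have := H ord0; apply/negP.
rewrite patchE mem_setE; case: ifPn => _; last by rewrite integral0.
by apply: IH => k; [exact: t0|exact: xi0].
Qed.

End TupleIntegration.

(** * Decay of the transform of a tail integral *)

Section TailIntegrals.
Variable R : realType.
Local Notation leb := (@lebesgue_measure R).
Local Notation lam := (lebesgue_tuple R).

Lemma ae_no_zero_coord d : {ae lam d, forall x, no_zero_coord x}.
Proof.
apply: filter_forall => k.
pose A (i : 'I_d) : set (measurableTypeR R) := if i == k then [set 0] else setT.
have AE : [set x : Rtuple R d | tnth x k = 0] =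
    [set x : Rtuple R d | forall i, A i (tnth x i)].
  apply/seteqP; split => x /= => [xk i|/(_ k)]; rewrite /A; last by rewrite eqxx.
  by case: eqP => // ->.
have mA i : measurable (A i).
  by rewrite /A; case: ifP => _; [exact: measurable_set1|exact: measurableT].
exists [set x : Rtuple R d | tnth x k = 0]; split.
- by rewrite AE; exact: measurable_coordwise.
- rewrite AE; apply: eq_trans (power_measure_box leb mA) _.
  by rewrite (bigD1 k)//= /A eqxx lebesgue_measure_set1 mul0e.
- by move=> x /= /negP; rewrite negbK => /eqP.
Qed.

Definition abs_tuple d (x : Rtuple R d) : Rtuple R d :=
  [tuple `|tnth x k| | k < d].

Lemma orthant_abs_tuple d (x : Rtuple R d) :
  no_zero_coord x -> orthant (abs_tuple x).
Proof. by move=> xn k; rewrite tnth_mktuple normr_gt0. Qed.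

(** The pairing of x and t behind an even tail integral, read as a quadrant in t
   for the definition of f and as a box in x for its transform. *)
Lemma upper_quadrant_abs_tuple d (x t : Rtuple R d) :
  upper_quadrant (abs_tuple x) t <-> symbox (tnth t) x.
Proof. by split => H k; have := H k; rewrite tnth_mktuple. Qed.

Lemma measurable_upper_quadrant d (y : Rtuple R d) :
  measurable (upper_quadrant y).
Proof.
rewrite (_ : upper_quadrant y = [set x | forall k,
    (`[tnth y k, +oo[%classic : set (measurableTypeR R)) (tnth x k)]).
  apply: (measurable_coordwise (A := fun k => `[tnth y k, +oo[%classic)) => k.
  exact: measurable_itv.
by apply/seteqP; split => x xo k; have := xo k; rewrite /= in_itv/= andbT.
Qed.

Lemma measurable_indic_symbox d (x : Rtuple R d) :
  measurable_fun setT (fun t : Rtuple R d => \1_(symbox (tnth t)) x : R).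
Proof.
have -> : (fun t => \1_(symbox (tnth t)) x : R) =
    \1_(upper_quadrant (abs_tuple x)).
  apply/funext => t; rewrite !indicE; congr (nat_of_bool _)%:R.
  by apply/idP/idP; rewrite !inE => /upper_quadrant_abs_tuple.
by apply: measurable_indic; exact: measurable_upper_quadrant.
Qed.

Lemma norm_sin_le (u : R) : `|sin u| <= `|u|.
Proof.
wlog u0 : u / 0 <= u.
  move=> H; have [|/ltW u0] := leP 0 u; first exact: H.
  by rewrite -[X in sin X]opprK sinN normrN -[leRHS]normrN H// oppr_ge0.
have cs : {within `[0, u], continuous (@sin R)}.
  by apply: continuous_subspaceT; exact: continuous_sin.
have [c _] := MVT_segment u0 (fun x _ => is_derive_sin x) cs.
rewrite sin0 !subr0 => ->; rewrite normrM -[leRHS]mul1r.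
by rewrite ler_wpM2r// cos_max.
Qed.

Definition decay d (xi : 'I_d -> R) : R := \prod_k (Num.max 1 `|xi k|) `^ (-1).

Lemma decay_ge0 d (xi : 'I_d -> R) : 0 <= decay xi.
Proof. by apply: prodr_ge0 => k _; exact: powR_ge0. Qed.

Lemma norm_sinc_le (t T xi : R) : 0 < t -> t <= T -> xi != 0 ->
  `|2 * sin (t * xi) / xi| <= 2 * Num.max 1 T * (Num.max 1 `|xi|) `^ (-1).
Proof.
move=> t0 tT xi0; have nx : 0 < `|xi| by rewrite normr_gt0.
rewrite powRN powRr1 ?le_max ?ler01//.
rewrite !normrM normfV ger0_norm// -!mulrA ler_pM2l//.
have [x1|x1] := leP `|xi| 1.
  rewrite divr1 ler_pdivrMr//.
  apply: le_trans (norm_sin_le _) _; rewrite normrM ler_pM2r//.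
  by rewrite gtr0_norm// le_max tT orbT.
apply: ler_wpM2r; first by rewrite invr_ge0.
by apply: le_trans (sin_max _) _; rewrite le_max lexx.
Qed.

Lemma norm_prod_sinc_le d (t : 'I_d -> R) (T : R) (xi : 'I_d -> R) :
  (forall k, 0 < t k <= T) -> (forall k, xi k != 0) ->
  `|\prod_k (2 * sin (t k * xi k) / xi k)| <= (2 * Num.max 1 T) ^+ d * decay xi.
Proof.
move=> tT xi0; rewrite normr_prod.
have -> : (2 * Num.max 1 T) ^+ d = \prod_(k < d) (2 * Num.max 1 T).
  by rewrite prodr_const card_ord.
rewrite /decay -big_split/=; apply: ler_prod => k _; rewrite normr_ge0/=.
by have /andP[? ?] := tT k; exact: norm_sinc_le.
Qed.

Lemma eq_off_hyperplanes_integral d (f f' : Rtuple R d -> R) :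
  measurable_fun setT f -> measurable_fun setT f' ->
  (forall x, no_zero_coord x -> f x = f' x) ->
  (\int[lam d]_x (f x)%:E = \int[lam d]_x (f' x)%:E)%E.
Proof.
move=> mf mf' ff'; apply: ae_eq_integral => //; try exact/measurable_EFinP.
by apply: filterS (ae_no_zero_coord d) => x xn _; rewrite ff'.
Qed.

(** Fubini: integrating out the point first turns the tail integral into a
   superposition, with density w, of the transforms of boxes. *)
Lemma tail_fourier_le d (T : R) (w f : Rtuple R d -> R) :
  (lam d).-integrable setT (EFin \o w) ->
  (forall t, w t != 0 -> forall k, 0 < tnth t k <= T) ->
  measurable_fun setT f ->
  (forall x, no_zero_coord x ->
    (f x)%:E = \int[lam d]_t (\1_(symbox (tnth t)) x * w t)%:E)%E ->
  forall theta (xi : 'I_d -> R), (forall k, xi k != 0) ->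
  (`|\int[lam d]_x (f x * cos (theta + dot x xi))%:E| <=
    ((2 * Num.max 1 T) ^+ d * decay xi)%:E * \int[lam d]_t `|(w t)%:E|)%E.
Proof.
move=> iw wT mf fw theta xi xi0.
have mw : measurable_fun setT w by have /measurable_int/measurable_EFinP := iw.
pose E : set (Rtuple R d * Rtuple R d) := [set z | symbox (tnth z.2) z.1].
have mE : measurable E.
  rewrite (_ : E = \bigcap_(k in [set: 'I_d])
     [set z : Rtuple R d * Rtuple R d | `|tnth z.1 k| <= tnth z.2 k]); last first.
    by apply/seteqP; split => z /= zE => [k _|k]; [exact: zE|exact: (zE k I)].
  apply: fin_bigcap_measurable => // k _.
  have mle : measurable_fun setT (fun z : Rtuple R d * Rtuple R d =>
      `|tnth z.1 k : R| <= tnth z.2 k).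
    apply: measurable_fun_ler.
      apply: (measurableT_comp (@normr_measurable R setT)).
      exact: (measurableT_comp (measurable_tnth k) measurable_fst).
    exact: (measurableT_comp (measurable_tnth k) measurable_snd).
  by have := mle measurableT [set true] I; rewrite setTI.
pose Phi (z : Rtuple R d * Rtuple R d) : \bar R :=
  (\1_E z * w z.2 * cos (theta + dot z.1 xi))%:E.
have mPhi : measurable_fun setT Phi.
  apply/measurable_EFinP; apply: measurable_funM.
    apply: measurable_funM; first exact: measurable_indic.
    exact: (measurableT_comp mw measurable_snd).
  exact: (measurableT_comp (measurable_cos_dot theta xi) measurable_fst).
have bT := measure_symbox_lty (fun _ : 'I_d => T).
have bE : (lam d (symbox (fun _ : 'I_d => T)) =
    \int[lam d]_x (\1_(symbox (fun _ : 'I_d => T)) x)%:E)%E.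
  by rewrite integral_indic ?setIT//; exact: measurable_symbox.
have wfin : (\int[lam d]_t `|(w t)%:E| < +oo)%E by case/integrableP: iw.
have EE x t : \1_E (x, t) = \1_(symbox (tnth t)) x :> R.
  by rewrite !indicE; congr (nat_of_bool _)%:R; apply/idP/idP; rewrite !inE.
(* On the support of w the box of t lies in the fixed box of half-side T. *)
have iPhi : (lam d \x lam d)%E.-integrable setT Phi.
  apply/integrable21ltyP => //.
  apply: (@le_lt_trans _ _ (\int[lam d]_t
      (lam d (symbox (fun _ : 'I_d => T)) * `|(w t)%:E|))%E).
    apply: ge0_le_integralT => t; first exact: integral_ge0.
    rewrite bE muleC -ge0_integralZl//; last first.
      by apply/measurable_EFinP; apply: measurable_indic; exact: measurable_symbox.
    apply: ge0_le_integralT => x //.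
    rewrite /Phi -!EFinM !abse_EFin lee_fin EE !normrM /=.
    have [->|wt0] := eqVneq (w t) 0; first by rewrite normr0 !mul0r mulr0 mul0r.
    rewrite -[leRHS]mulr1; apply: ler_pM => //; last exact: cos_max.
    rewrite mulrC ler_pM2l ?normr_gt0// !indicE.
    case: (boolP (x \in symbox (tnth t))) => [|_]; last by rewrite normr0.
    rewrite inE => xt; rewrite mem_set ?normr1// => k.
    by apply: le_trans (xt k) _; have /andP[] := wT t wt0 k.
  rewrite ge0_integralZl//; last 1 first.
    by apply: measurableT_comp => //; apply/measurable_EFinP.
  by apply: lte_mul_pinfty => //; rewrite ge0_fin_numE.
have inner1 x : no_zero_coord x ->
    (\int[lam d]_t Phi (x, t) = (f x * cos (theta + dot x xi))%:E)%E.
  move=> xn; rewrite EFinM (fw x xn) muleC -integralZl//.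
    apply: eq_integral => t _; rewrite /Phi EE -EFinM; congr EFin.
    by rewrite mulrC.
  apply/integrableP; split.
    apply/measurable_EFinP; apply: measurable_funM => //.
    exact: measurable_indic_symbox.
  apply: le_lt_trans wfin; apply: ge0_le_integralT => t //.
  rewrite !abse_EFin lee_fin normrM -[leRHS]mul1r ler_wpM2r//.
  exact: normr_indic_le1.
have inner2 t : (\int[lam d]_x Phi (x, t) =
    (w t * (cos theta * \prod_k (2 * sin (tnth t k * xi k) / xi k)))%:E)%E.
  have [wt0|wt0] := eqVneq (w t) 0.
    under eq_integral do rewrite /Phi/= wt0 mulr0 mul0r.
    by rewrite integral0 wt0 mul0r.
  rewrite EFinM -integral_symbox_cos//; last first.
    by move=> k; have /andP[] := wT t wt0 k.
  rewrite -integralZl//; last exact: integrable_symbox_cos.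
  apply: eq_integral => x _; rewrite /Phi EE -EFinM; congr EFin => /=.
  by rewrite [RHS]mulrA [w t * _]mulrC.
have -> : (\int[lam d]_x (f x * cos (theta + dot x xi))%:E =
           \int[lam d]_x \int[lam d]_t Phi (x, t))%E.
  apply: ae_eq_integral => //.
  - apply/measurable_EFinP; apply: measurable_funM => //.
    exact: measurable_cos_dot.
  - exact: (measurable_fubini_F iPhi).
  - by apply: filterS (ae_no_zero_coord d) => x xn _; rewrite inner1.
rewrite (Fubini iPhi).
apply: le_trans (le_abse_integral _ _ _) _ => //.
  exact: (measurable_fubini_G iPhi).
rewrite -ge0_integralZl//; last 2 first.
- by apply: measurableT_comp => //; apply/measurable_EFinP.
- by rewrite lee_fin mulr_ge0 ?decay_ge0// exprn_ge0// mulr_ge0// le_max ler01.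
apply: ge0_le_integralT => t //.
rewrite inner2 !abse_EFin -EFinM lee_fin normrM mulrC.
have [->|wt0] := eqVneq (w t) 0; first by rewrite normr0 !mulr0.
rewrite ler_pM2r ?normr_gt0// normrM -[leRHS]mul1r.
apply: ler_pM => //; first exact: cos_max.
by apply: norm_prod_sinc_le => // k; exact: wT.
Qed.

End TailIntegrals.

(** * The Abel transform is the ordinary transform *)

Section AbelLimit.
Variable R : realType.
Local Notation lam := (lebesgue_tuple R).

Lemma sinE_cos (u : R) : sin u = cos (- (pi / 2) + u).
Proof. by rewrite cosD cosN cos_pihalf sinN sin_pihalf mul0r mulN1r sub0r opprK. Qed.

Lemma complex_norm_le (z : R[i]) :
  complex.Re `|z| <= `|complex.Re z| + `|complex.Im z|.
Proof.
rewrite normc_def /=.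
have s0 : 0 <= `|complex.Re z| + `|complex.Im z| by rewrite addr_ge0.
rewrite -[leRHS](ger0_norm s0) -sqrtr_sqr ler_wsqrtr//.
rewrite sqrrD !real_normK ?num_real// [leRHS]addrAC lerDl.
by rewrite mulrn_wge0// mulr_ge0.
Qed.

Lemma ler_Re_complex_norm (z : R[i]) : complex.Re z <= complex.Re `|z|.
Proof.
have := normc_ge_Re z; rewrite lecE => /andP[_ /=].
by apply: le_trans; exact: ler_norm.
Qed.

Lemma measurable_damping d (eps : 'I_d -> R) :
  measurable_fun setT
    (fun x : Rtuple R d => expR (- \sum_k eps k * `|tnth x k|)).
Proof.
apply: (measurableT_comp (@measurable_expR R)).
apply: measurable_funN; apply: measurable_sum => k; apply: measurable_funM => //.
exact: (measurableT_comp (@normr_measurable R setT) (measurable_tnth k)).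
Qed.

Lemma damped_fourierE d (f : Rtuple R d -> R) (eps : 'rV[R]_d)
    (xi : Rtuple R d) :
  damped_fourier f eps xi =
  (\int[lam d]_x (f x * expR (- \sum_k eps ord0 k * `|tnth x k|) *
                    cos (0 + dot x (tnth xi)))
   +i* \int[lam d]_x (f x * expR (- \sum_k eps ord0 k * `|tnth x k|) *
                    cos (- (pi / 2) + dot x (tnth xi))))%C.
Proof.
rewrite /damped_fourier /Cintegral; congr (_ +i* _)%C;
  apply: eq_Rintegral => x _; rewrite /expi /dot /=.
  by rewrite mul0r subr0 add0r.
by rewrite mul0r addr0 -sinE_cos.
Qed.

(** From 1 - exp(-u) <= u. *)
Lemma damped_integral_close d (f h : Rtuple R d -> R) (T : R)
    (eps : 'I_d -> R) :
  (lam d).-integrable setT (EFin \o f) ->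
  (forall x, f x != 0 -> forall k, `|tnth x k| <= T) ->
  (forall k, 0 < eps k) -> measurable_fun setT h -> (forall x, `|h x| <= 1) ->
  `|\int[lam d]_x (f x * h x) -
    \int[lam d]_x (f x * expR (- \sum_k eps k * `|tnth x k|) * h x)| <=
  (\sum_k eps k * T) * \int[lam d]_x `|f x|.
Proof.
move=> intf fT eps0 mh h1.
have mf : measurable_fun setT f by have /measurable_int/measurable_EFinP := intf.
have iab : (lam d).-integrable setT (EFin \o (fun x => `|f x|)).
  by have := integrable_abse intf.
pose E (x : Rtuple R d) := expR (- \sum_k eps k * `|tnth x k|).
have mE : measurable_fun setT E by exact: measurable_damping.
have s0 x : 0 <= \sum_k eps k * `|tnth x k : R|.
  by apply: sumr_ge0 => k _; rewrite mulr_ge0// ltW.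
have E1 x : `|E x| <= 1.
  by rewrite ger0_norm ?expR_ge0// -expR0 ler_expR oppr_le0.
have dom (u : Rtuple R d -> R) :
    measurable_fun setT u -> (forall x, `|u x| <= 1) ->
    (lam d).-integrable setT (EFin \o (fun x => f x * u x)).
  move=> mu u1; apply: le_integrable intf => //.
    by apply/measurable_EFinP; exact: measurable_funM.
  move=> x _; rewrite !abse_EFin lee_fin normrM -[leRHS]mulr1.
  by apply: ler_pM.
have ifh := dom h mh h1.
have ifEh : (lam d).-integrable setT (EFin \o (fun x => f x * E x * h x)).
  have : (lam d).-integrable setT (EFin \o (fun x => f x * (E x * h x))).
    apply: dom; first exact: measurable_funM.
    by move=> x; rewrite normrM -[leRHS]mulr1; apply: ler_pM.
  by congr (integrable _ _ _); apply/funext => x /=; rewrite mulrA.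
rewrite -RintegralB//.
apply: le_trans (le_normr_Rintegral _ _) _ => //.
  by have := integrableB measurableT ifh ifEh.
rewrite -RintegralZl//; apply: le_Rintegral => //.
- have := integrable_abse (integrableB measurableT ifh ifEh).
  by [].
- have := integrableZl measurableT (\sum_k eps k * T) iab.
  by [].
move=> x _.
have -> : f x * h x - f x * E x * h x = f x * ((1 - E x) * h x) by ring.
have [->|fx0] := eqVneq (f x) 0; first by rewrite mul0r normr0 mulr0.
rewrite normrM mulrC ler_pM2r ?normr_gt0// normrM -[leRHS]mulr1.
apply: ler_pM => //.
rewrite ger0_norm; last by rewrite subr_ge0 (le_trans (ler_norm _) (E1 x)).
apply: (@le_trans _ _ (\sum_k eps k * `|tnth x k : R|)).
  by rewrite lerBlDr -lerBlDl; exact: expR_ge1Dx.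
by apply: ler_sum => k _; rewrite ler_pM2l//; exact: fT.
Qed.

Lemma abel_filter_proper d : ProperFilter (@abel_filter R d).
Proof.
apply: within_nbhs_proper => B /nbhs_ballP[e /= e0 eB].
exists (const_mx (e / 2)); split => [k|]; first by rewrite mxE divr_gt0.
apply: eB; split => // i j; rewrite /ball/= !mxE sub0r normrN gtr0_norm ?divr_gt0//.
by rewrite ltr_pdivrMr// ltr_pMr// ltr1n.
Qed.

(** The support is bounded, so the damping factor tends to 1 uniformly on it,
   however the parameters tend to zero. *)
Lemma abel_fourierE d (f : Rtuple R d -> R) (T : R) (xi : Rtuple R d) :
  (lam d).-integrable setT (EFin \o f) -> 0 <= T ->
  (forall x, f x != 0 -> forall k, `|tnth x k| <= T) ->
  no_zero_coord xi ->
  abel_fourier f xi =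
  (\int[lam d]_x (f x * cos (0 + dot x (tnth xi)))
    +i* \int[lam d]_x (f x * cos (- (pi / 2) + dot x (tnth xi))))%C.
Proof.
move=> intf T0 fT xi0; rewrite /abel_fourier ifT; last by apply/forallP.
have abel_proper := @abel_filter_proper d.
set L := (_ +i* _)%C.
apply: (@cvg_lim R[i]^o); first exact: norm_hausdorff.
apply/cvgrPdist_le => e e0.
have Ree : (complex.Re e)%:C%C = e by rewrite RRe_real// gtr0_real.
have e'0 : 0 < complex.Re e by rewrite -ltcR Ree.
set e' := complex.Re e in Ree e'0.
pose I := \int[lam d]_x `|f x|.
have I0 : 0 <= I by apply: Rintegral_ge0.
(* With all eps_k < eta, each of the real and imaginary parts moves by at most
   d eta T I, which is at most e' / 2. *)
pose eta := e' / (2 * (d.+1%:R * (T * I + 1))).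
have D0 : 0 < 2 * (d.+1%:R * (T * I + 1)).
  by rewrite !mulr_gt0// ltr_wpDl// mulr_ge0.
have eta0 : 0 < eta by rewrite divr_gt0.
have near_small : \forall eps \near (@abel_filter R d : set_system _),
    forall k : 'I_d, 0 < (eps : 'rV[R]_d) ord0 k < eta.
  rewrite /abel_filter/= near_withinE; apply/nbhs_ballP; exists eta => //= eps H ep k.
  have := H.2 ord0 k; rewrite /ball/= !mxE sub0r normrN => He.
  by rewrite ep/= (le_lt_trans (ler_norm _) He).
apply: filterS near_small => eps epsP; rewrite -Ree damped_fourierE.
have close := @damped_integral_close d f _ T (fun k => eps ord0 k) intf fT
  (fun k => proj1 (andP (epsP k))) (measurable_cos_dot _ (tnth xi))
  (fun x => cos_max _).
have small : (\sum_k eps ord0 k * T) * I <= e' / 2.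
  apply: (@le_trans _ _ ((\sum_(k < d) eta * T) * I)).
    apply: ler_wpM2r => //; apply: ler_sum => k _; apply: ler_wpM2r => //.
    by have /andP[_ /ltW] := epsP k.
  have -> : (\sum_(k < d) eta * T) * I = eta * (d%:R * (T * I)).
    by rewrite sumr_const card_ord -[X in X * I]mulr_natr; ring.
  apply: (@le_trans _ _ (eta * (d.+1%:R * (T * I + 1)))).
    rewrite ler_pM2l//; apply: ler_pM => //; first by rewrite mulr_ge0.
      by rewrite ler_nat.
    by rewrite lerDl.
  rewrite /eta le_eqVlt; apply/orP; left; apply/eqP; field.
  by rewrite gt_eqF//= ?gt_eqF// ltr_wpDl// mulr_ge0.
have nE (z : R[i]) : `|z| = (complex.Re `|z|)%:C%C.
  by rewrite RRe_real// normr_real.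
rewrite [X in X <= _]nE lecR; apply: le_trans (complex_norm_le _) _.
rewrite -[e'](@divfK _ 2)// mulr_natr mulr2n.
by apply: lerD; apply: le_trans (close _) small.
Qed.

End AbelLimit.

(** * Nonnegative functions of bounded support, positive near the origin *)

Section Profiles.
Variable R : realType.
Local Notation lam := (lebesgue_tuple R).

(** What the three families have in common, in the form that the norm estimates
   use. *)
Record profile d (f : Rtuple R d -> R) (M T r delta : R) : Prop := Profile {
  profile_measurable : measurable_fun setT f;
  profile_bounds : forall x, 0 <= f x <= M;
  profile_support : forall x, f x != 0 -> forall k, `|tnth x k| <= T;
  profile_near0 : forall x, (forall k, 0 < tnth x k <= r) -> delta <= f x;
  profile_T : 0 <= T;
  profile_r : 0 < r;
  profile_delta : 0 < delta }.

Lemma profile_integrable d (f : Rtuple R d -> R) M T r delta :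
  profile f M T r delta -> (lam d).-integrable setT (EFin \o f).
Proof.
case=> mf fM fT _ _ _ _; apply: (@integrable_symbox _ _ (fun=> T) _ M) => //.
  by move=> x; have /andP[f0 ?] := fM x; rewrite ger0_norm.
by move=> x xT; apply/eqP/negPn/negP => fx; apply: xT; exact: fT fx.
Qed.

Lemma profile_integral_gt0 d (f : Rtuple R d -> R) M T r delta :
  profile f M T r delta -> 0 < \int[lam d]_x f x.
Proof.
move=> pf; have intf := profile_integrable pf.
case: pf => mf fM fT fr T0 r0 delta0.
pose A (k : 'I_d) : set (measurableTypeR R) := `]0, r]%classic.
pose B := [set x : Rtuple R d | forall k, A k (tnth x k)].
have mA k : measurable (A k) by exact: measurable_itv.
have mB : measurable B by exact: measurable_coordwise.
have BE : lam d B = (r ^+ d)%:E.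
  apply: eq_trans (power_measure_box _ mA) _.
  rewrite (eq_bigr (fun _ => r%:E)).
    by rewrite prodEFin prodr_const card_ord.
  move=> k _; apply: eq_trans (lebesgue_measure_itv (`]0%R, r] : interval R)) _.
  by rewrite /= lte_fin r0 sube0.
rewrite -lte_fin fineK; last exact: integrable_fin_num.
apply: (@lt_le_trans _ _ (delta%:E * (r ^+ d)%:E)%E).
  by rewrite -EFinM lte_fin mulr_gt0 ?exprn_gt0.
have -> : (r ^+ d)%:E = (\int[lam d]_x (\1_B x)%:E)%E.
  by rewrite integral_indic// setIT.
rewrite -ge0_integralZl//; last 2 first.
- by apply/measurable_EFinP; exact: measurable_indic.
- by rewrite lee_fin ltW.
apply: ge0_le_integralT => x; first by rewrite mule_ge0// lee_fin ltW.
rewrite -EFinM lee_fin indicE; case: (boolP (x \in B)) => [|_]; last first.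
  by rewrite mulr0; have /andP[] := fM x.
rewrite inE mulr1 => Bx; apply: fr => k.
by have := Bx k; rewrite /A/= in_itv.
Qed.

(** For small xi the phase is small on the whole of the bounded support, so the
   cosine exceeds 1/2 there, and the transform is at least half of the integral
   of f. *)
Lemma profile_fourier_near0 d (f : Rtuple R d -> R) M T r delta :
  profile f M T r delta ->
  exists rho delta', [/\ 0 < rho, 0 < delta' &
    forall xi : 'I_d -> R, (forall k, `|xi k| <= rho) ->
      delta' <= \int[lam d]_x (f x * cos (0 + dot x xi))].
Proof.
move=> pf; have intf := profile_integrable pf; have I0 := profile_integral_gt0 pf.
case: pf => mf fM fT fr T0 r0 delta0.
have : \forall u \near (0 : R), 2^-1 < cos u.
  have := @continuous_cos R 0; rewrite /continuous_at cos0 => /cvgr_gt; apply.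
  by rewrite invf_lt1// ltr1n.
move=> /nbhs_ballP[c /= c0 cP].
pose D : R := d.+1%:R * (T + 1).
have D0 : 0 < D by rewrite mulr_gt0// ltr_wpDl.
exists (c / (2 * D)), ((\int[lam d]_x f x) / 2); split.
- by rewrite divr_gt0// mulr_gt0.
- by rewrite divr_gt0.
move=> xi xic.
have dotc x : f x != 0 -> `|dot x xi| < c.
  move=> fx; apply: (@le_lt_trans _ _ (c / 2)); last by lra.
  apply: le_trans (ler_norm_sum _ _ _) _.
  apply: (@le_trans _ _ (\sum_(k < d) T * (c / (2 * D)))).
    apply: ler_sum => k _; rewrite normrM; apply: ler_pM => //.
    exact: fT fx k.
  have -> : \sum_(k < d) T * (c / (2 * D)) = d%:R * T * (c / (2 * D)).
    by rewrite sumr_const card_ord -[LHS]mulr_natl mulrA.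
  have -> : c / 2 = D * (c / (2 * D)) by field; rewrite gt_eqF.
  apply: ler_wpM2r.
    by apply: divr_ge0; [exact: ltW|rewrite mulr_ge0// ltW].
  by rewrite /D; apply: ler_pM => //; [rewrite ler_nat|rewrite lerDl].
rewrite mulrC -RintegralZl//; apply: le_Rintegral => //.
- by have := integrableZl measurableT 2^-1 intf.
- apply: le_integrable intf => //.
    by apply/measurable_EFinP; apply: measurable_funM => //; exact: measurable_cos_dot.
  move=> x _; rewrite !abse_EFin lee_fin normrM -[leRHS]mulr1.
  by apply: ler_pM => //; exact: cos_max.
move=> x _; have [->|fx0] := eqVneq (f x) 0; first by rewrite mulr0 mul0r.
rewrite add0r mulrC; have /andP[f0 _] := fM x; apply: ler_wpM2l => //.
by apply/ltW/cP; rewrite /ball/= sub0r normrN; exact: dotc.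
Qed.

Lemma weight_no_zero d (rho : 'I_d -> R) (x : Rtuple R d) : no_zero_coord x ->
  weight rho x = \prod_k `|tnth x k| `^ rho k.
Proof. by move=> xn; rewrite /weight ifT//; apply/forallP. Qed.

Lemma weight_zero d (rho : 'I_d -> R) (x : Rtuple R d) : ~ no_zero_coord x ->
  weight rho x = 0.
Proof. by move=> xn; rewrite /weight ifF//; apply/negP => /forallP. Qed.

Lemma no_zero_coord_pos d (x : Rtuple R d) (r : R) :
  (forall k, 0 < tnth x k <= r) -> no_zero_coord x.
Proof. by move=> xr k; have /andP[x0 _] := xr k; rewrite gt_eqF. Qed.

Definition fourier_decay d (f : Rtuple R d -> R) (C : R) :=
  forall theta (xi : 'I_d -> R), (forall k, xi k != 0) ->
    `|\int[lam d]_x (f x * cos (theta + dot x xi))| <= C * decay xi.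

Lemma fourier_norm_lty d (f : Rtuple R d -> R) M T r delta C
    (alpha q : 'I_d -> R) :
  profile f M T r delta -> fourier_decay f C -> (forall k, 0 < q k) ->
  (forall k, - (1 / q k) < alpha k < 1 - 1 / q k) ->
  (fourier_norm alpha q f < +oo)%E.
Proof.
move=> pf fC q0 aq.
apply: (@mixed_norm_lty _ _ q alpha (fun=> 1) (`|C| + `|C|)) => //.
- move=> k; have /andP[h _] := aq k.
  by rewrite -ltr_pdivrMr// mulN1r -div1r.
- move=> k; have /andP[_ h] := aq k.
  by rewrite -ltr_pdivlMr// mulN1r -div1r ltrBlDr addrC.
move=> xi; have [xin|xin] := pselect (no_zero_coord xi); last first.
  rewrite weight_zero// mul0r abse0 lee_fin mulr_ge0 ?addr_ge0//.
  by apply: prodr_ge0 => k _; rewrite mulr_ge0 ?powR_ge0.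
have FC : complex.Re `|abel_fourier f xi| <= (`|C| + `|C|) * decay (tnth xi).
  rewrite (abel_fourierE (profile_integrable pf) (profile_T pf)
    (profile_support pf))//.
  apply: le_trans (complex_norm_le _) _; rewrite /= [leRHS]mulrDl.
  have dC theta : `|\int[lam d]_x (f x * cos (theta + dot x (tnth xi)))| <=
      `|C| * decay (tnth xi).
    apply: le_trans (fC theta (tnth xi) xin) _.
    by apply: ler_wpM2r; [exact: decay_ge0|exact: ler_norm].
  by apply: lerD; exact: dC.
have F0 : 0 <= complex.Re `|abel_fourier f xi|.
  by have := normr_ge0 (abel_fourier f xi); rewrite lecE => /andP[].
move: FC F0; move: (complex.Re `|abel_fourier f xi|) => F FC F0.
have w0 : 0 <= \prod_k `|tnth xi k| `^ alpha k.
  by apply: prodr_ge0 => k _; exact: powR_ge0.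
rewrite weight_no_zero// abse_EFin lee_fin normrM (ger0_norm w0) (ger0_norm F0).
by rewrite /tempered_power big_split/= [leRHS]mulrCA; exact: ler_wpM2l.
Qed.

Lemma fourier_norm_infty d (f : Rtuple R d -> R) M T r delta
    (alpha q : 'I_d -> R) :
  profile f M T r delta -> (forall k, 0 < q k) ->
  (exists k, alpha k <= - (1 / q k)) -> fourier_norm alpha q f = +oo%E.
Proof.
move=> pf q0 [k aq].
have [rho [delta' [rho0 delta'0 near0]]] := profile_fourier_near0 pf.
apply: (@mixed_norm_infty _ _ q alpha rho delta') => //.
  by exists k; rewrite -ler_pdivlMr// mulN1r -div1r.
move=> xi xir; have xin := no_zero_coord_pos xir.
rewrite weight_no_zero// abse_EFin lee_fin.
apply: le_trans (ler_norm _); rewrite mulrC.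
apply: ler_wpM2l; first by apply: prodr_ge0 => i _; exact: powR_ge0.
rewrite (abel_fourierE (profile_integrable pf) (profile_T pf)
  (profile_support pf))//.
apply: le_trans (ler_Re_complex_norm _) => /=.
by apply: near0 => i; have /andP[x0 x1] := xir i; rewrite gtr0_norm.
Qed.

(** On the support of f one has |x_k| <= T, so f is at most a constant times the
   product of the max(1, |x_k|)^-b_k for any b_k >= 0; the choice
   b_k = beta_k + 2 makes the power at infinity equal to -2. *)
Lemma spatial_norm_lty d (f : Rtuple R d -> R) M T r delta
    (beta p : 'I_d -> R) :
  profile f M T r delta -> (forall k, 1 <= p k) ->
  (forall k, - (1 / p k) < beta k) ->
  (spatial_norm beta p f < +oo)%E.
Proof.
move=> pf p1 bp; case: pf => mf fM fT fr T0 r0 delta0.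
have p0 k : 0 < p k by exact: lt_le_trans (p1 k).
have b1 k : 0 <= beta k + 2.
  have : (p k)^-1 <= 1 by rewrite invf_le1.
  by have := bp k; rewrite div1r; lra.
have T1 : 0 < Num.max 1 T by rewrite lt_max ltr01.
have M0 : 0 <= M.
  by have /andP[h1 h2] := fM [tuple 0 | _ < d]; exact: le_trans h1 h2.
pose K := \prod_k (Num.max 1 T) `^ (beta k + 2).
have K0 : 0 <= K by apply: prodr_ge0 => k _; exact: powR_ge0.
apply: (@mixed_norm_lty _ _ p beta (fun k => beta k + 2) (M * K)) => //.
- by rewrite mulr_ge0.
- move=> k; rewrite -ltr_pdivrMr// mulN1r -div1r; exact: bp.
- move=> k; rewrite opprD addrA subrr add0r.
  by have := p1 k; lra.
move=> x; rewrite abse_EFin lee_fin.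
have tp0 : 0 <= \prod_k tempered_power (beta k) (beta k + 2) (tnth x k).
  by apply: prodr_ge0 => k _; rewrite mulr_ge0 ?powR_ge0.
have [xn|xn] := pselect (no_zero_coord x); last first.
  by rewrite weight_zero// mul0r normr0 !mulr_ge0.
have [->|fx0] := eqVneq (f x) 0; first by rewrite mulr0 normr0 !mulr_ge0.
have /andP[f0 fxM] := fM x.
rewrite weight_no_zero// normrM (ger0_norm f0) mulrC ger0_norm; last first.
  by apply: prodr_ge0 => k _; exact: powR_ge0.
rewrite -mulrA; apply: ler_pM => //.
  by apply: prodr_ge0 => k _; exact: powR_ge0.
rewrite /K -big_split/=; apply: ler_prod => k _; rewrite powR_ge0/=.
rewrite /tempered_power mulrCA -[leLHS]mulr1.
apply: ler_wpM2l; first exact: powR_ge0.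
rewrite powRN ler_pdivlMr ?mul1r; last by rewrite powR_gt0// lt_max ltr01.
have mx0 (u : R) : Num.max 1 u \in Num.nneg by rewrite nnegrE le_max ler01.
apply: ge0_ler_powR => //.
by rewrite ge_max le_max lexx/= le_max (fT x fx0 k) orbT.
Qed.

Lemma spatial_norm_infty d (f : Rtuple R d -> R) M T r delta
    (beta p : 'I_d -> R) :
  profile f M T r delta -> (forall k, 0 < p k) ->
  (exists k, beta k <= - (1 / p k)) -> spatial_norm beta p f = +oo%E.
Proof.
move=> pf p0 [k bp]; case: pf => mf fM fT fr T0 r0 delta0.
apply: (@mixed_norm_infty _ _ p beta r delta) => //.
  by exists k; rewrite -ler_pdivlMr// mulN1r -div1r.
move=> x xr; rewrite weight_no_zero; last exact: no_zero_coord_pos xr.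
rewrite abse_EFin lee_fin; apply: le_trans (ler_norm _); rewrite mulrC.
apply: ler_wpM2l; first by apply: prodr_ge0 => i _; exact: powR_ge0.
exact: fr.
Qed.

Lemma abel_fourier_ext d (f f' : Rtuple R d -> R) :
  measurable_fun setT f -> measurable_fun setT f' ->
  (forall x, no_zero_coord x -> f x = f' x) ->
  abel_fourier f = abel_fourier f'.
Proof.
move=> mf mf' ff'.
suff E : damped_fourier f = damped_fourier f'.
  by apply/funext => xi; rewrite /abel_fourier E.
apply/funext => eps; apply/funext => xi; rewrite !damped_fourierE.
have me := measurable_damping (fun k => eps ord0 k).
have key theta :
    \int[lam d]_x (f x * expR (- \sum_k eps ord0 k * `|tnth x k|) *
                      cos (theta + dot x (tnth xi))) =
    \int[lam d]_x (f' x * expR (- \sum_k eps ord0 k * `|tnth x k|) *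
                      cos (theta + dot x (tnth xi))).
  congr fine; apply: eq_off_hyperplanes_integral.
  - by apply: measurable_funM; [exact: measurable_funM|exact: measurable_cos_dot].
  - by apply: measurable_funM; [exact: measurable_funM|exact: measurable_cos_dot].
  - by move=> x xn; rewrite ff'.
by congr (_ +i* _)%C; exact: key.
Qed.

End Profiles.

(** * Vanishing on the hyperplanes, and box differences *)

Section BoxExample.
Variable R : realType.
Local Notation lam := (lebesgue_tuple R).

(** The values of f on the coordinate hyperplanes are arbitrary; replacing them
   by zero changes neither norm, and makes the bounds of [profile] hold
   everywhere. *)
Definition off_hyperplanes d (f : Rtuple R d -> R) (x : Rtuple R d) : R :=
  f x * \1_[set x : Rtuple R d | no_zero_coord x] x.

Lemma off_hyperplanesE d (f : Rtuple R d -> R) x : no_zero_coord x ->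
  off_hyperplanes f x = f x.
Proof. by move=> xn; rewrite /off_hyperplanes indicE mem_set// mulr1. Qed.

Lemma off_hyperplanes0 d (f : Rtuple R d -> R) x : ~ no_zero_coord x ->
  off_hyperplanes f x = 0.
Proof. by move=> xn; rewrite /off_hyperplanes indicE memNset// mulr0. Qed.

Lemma measurable_off_hyperplanes d (f : Rtuple R d -> R) :
  measurable_fun setT f -> measurable_fun setT (off_hyperplanes f).
Proof.
move=> mf; apply: measurable_funM => //; apply: measurable_indic.
rewrite (_ : [set x | _] = [set x : Rtuple R d | forall k,
   (~` [set 0] : set (measurableTypeR R)) (tnth x k)]); last first.
  by apply/seteqP; split => x /= xn k; apply/eqP; exact: xn.
apply: (measurable_coordwise (A := fun=> ~` [set 0])) => k.
by apply: measurableC; exact: measurable_set1.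
Qed.

Lemma common_lower_bound d (a : 'I_d -> R) : (forall k, 0 < a k) ->
  exists2 r, 0 < r & forall k, r <= a k.
Proof.
move=> a0; exists (\big[Num.min/1]_k a k); last by move=> k; exact: bigmin_le.
by elim/big_ind : _ => // x y x0 y0; rewrite lt_min x0.
Qed.

Lemma common_upper_bound d (a : 'I_d -> R) : (forall k, 0 < a k) ->
  exists2 T, 0 <= T & forall k, a k <= T.
Proof.
move=> a0; exists (\sum_k a k); first by apply: sumr_ge0 => k _; exact: ltW.
move=> k; rewrite (bigD1 k)//= lerDl.
by apply: sumr_ge0 => i _; exact: ltW.
Qed.

(** Off the hyperplanes f is the indicator of the box of b minus c times that of
   the box of a; it is nonnegative because the second box lies in the first and
   c < 1. *)
Lemma box_difference_profile d (g f : Rtuple R d -> R) :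
  is_box_difference g -> even_extension g f ->
  exists M T r delta C, profile (off_hyperplanes f) M T r delta /\
    fourier_decay (off_hyperplanes f) C.
Proof.
move=> [_ [a [b [c [a0 b0 ab /andP[c0 c1] gE]]]]] [mf fE].
have [r r0 ra] := common_lower_bound a0.
have [T T0 bT] := common_upper_bound b0.
pose h x : R := \1_(symbox (tnth b)) x - c * \1_(symbox (tnth a)) x.
have boxE (v x : Rtuple R d) : no_zero_coord x ->
    \1_(lower_box v) (abs_tuple x) = \1_(symbox (tnth v)) x :> R.
  move=> xn; rewrite !indicE; congr (nat_of_bool _)%:R.
  by apply/idP/idP; rewrite !inE => H k; have := H k;
    rewrite tnth_mktuple normr_gt0 xn.
have fh x : no_zero_coord x -> off_hyperplanes f x = h x.
  move=> xn; rewrite off_hyperplanesE// fE// gE; last exact: orthant_abs_tuple.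
  by rewrite !boxE.
have sub x : symbox (tnth a) x -> symbox (tnth b) x.
  by move=> xa k; apply: le_trans (xa k) (ltW (ab k)).
have hP x : 0 <= h x <= 1.
  rewrite /h !indicE; case: (boolP (x \in symbox (tnth a))) => xa.
    move: (xa); rewrite inE => /sub xb; rewrite mem_set//=.
    by apply/andP; split; lra.
  by rewrite mulr0 subr0 ler0n lern1 leq_b1.
have mh : measurable_fun setT h.
  apply: measurable_funB; first by apply: measurable_indic; exact: measurable_symbox.
  by apply: measurable_funM => //; apply: measurable_indic; exact: measurable_symbox.
have mf0 := measurable_off_hyperplanes mf.
exists 1, T, r, (1 - c), ((2 * Num.max 1 T) ^+ d * (1 + c)); split.
  split => //; last by rewrite subr_gt0.
  - move=> x; have [xn|xn] := pselect (no_zero_coord x); first by rewrite fh.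
    by rewrite off_hyperplanes0// lexx ler01.
  - move=> x fx k; apply: le_trans (bT k).
    have xn : no_zero_coord x.
      by apply: contrapT => /off_hyperplanes0 H; move: fx; rewrite H eqxx.
    have [xb|xb] := pselect (symbox (tnth b) x); first exact: xb.
    move: fx; rewrite fh// /h !indicE memNset// memNset ?mulr0 ?subr0 ?eqxx//.
    by move=> /sub.
  - move=> x xr; have xn := no_zero_coord_pos xr.
    have xa : symbox (tnth a) x.
      by move=> k; have /andP[x0 xk] := xr k; rewrite gtr0_norm// (le_trans xk).
    by rewrite fh// /h !indicE !mem_set ?mulr1//; exact: sub.
move=> theta xi xi0.
have Ecos v : (forall k, 0 < tnth v k) -> (forall k, tnth v k <= T) ->
    `|\int[lam d]_x (\1_(symbox (tnth v)) x * cos (theta + dot x xi))| <=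
    (2 * Num.max 1 T) ^+ d * decay xi.
  move=> v0 vT; rewrite /Rintegral integral_symbox_cos// /= normrM -[leRHS]mul1r.
  apply: ler_pM => //; first exact: cos_max.
  by apply: norm_prod_sinc_le => // k; rewrite v0 vT.
have -> : \int[lam d]_x (off_hyperplanes f x * cos (theta + dot x xi)) =
  \int[lam d]_x (\1_(symbox (tnth b)) x * cos (theta + dot x xi)) -
  c * \int[lam d]_x (\1_(symbox (tnth a)) x * cos (theta + dot x xi)).
  rewrite -RintegralZl//; last exact: integrable_symbox_cos.
  rewrite -RintegralB//; last 2 first.
  - exact: integrable_symbox_cos.
  - have := integrableZl measurableT c (integrable_symbox_cos (tnth a) xi theta).
    by [].
  congr fine; apply: eq_off_hyperplanes_integral.
  - by apply: measurable_funM => //; exact: measurable_cos_dot.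
  - apply: (@eq_measurable_fun _ _ _ _ _ (fun x => h x * cos (theta + dot x xi))).
      by move=> x _; rewrite /h mulrBl mulrA.
    by apply: measurable_funM => //; exact: measurable_cos_dot.
  - by move=> x xn; rewrite fh// /h mulrBl mulrA.
apply: le_trans (ler_normB _ _) _; rewrite normrM (gtr0_norm c0).
have -> : (2 * Num.max 1 T) ^+ d * (1 + c) * decay xi =
  (2 * Num.max 1 T) ^+ d * decay xi + c * ((2 * Num.max 1 T) ^+ d * decay xi) by ring.
apply: lerD; first exact: Ecos.
rewrite ler_pM2l//; apply: Ecos => // k; exact: le_trans (ltW (ab k)) (bT k).
Qed.

End BoxExample.

(** * Tail integrals of a density *)

Section TailExample.
Variable R : realType.
Local Notation lam := (lebesgue_tuple R).

(** Shared by the integrable and the smooth densities: M is the total mass of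
   |w|, and the decay of the transform is [tail_fourier_le]. *)
Lemma tail_profile d (w f : Rtuple R d -> R) (T r delta : R) :
  (lam d).-integrable setT (EFin \o w) ->
  (forall t, w t != 0 -> forall k, 0 < tnth t k <= T) ->
  measurable_fun setT f ->
  (forall x, ~ no_zero_coord x -> f x = 0) ->
  (forall x, no_zero_coord x ->
    (f x)%:E = \int[lam d]_t (\1_(symbox (tnth t)) x * w t)%:E)%E ->
  (forall x, 0 <= f x) ->
  (forall x, (forall k, 0 < tnth x k <= r) -> delta <= f x) ->
  0 <= T -> 0 < r -> 0 < delta ->
  exists M C, profile f M T r delta /\ fourier_decay f C.
Proof.
move=> iw wT mf f0 fw fge0 fr T0 r0 delta0.
have mw : measurable_fun setT w by have /measurable_int/measurable_EFinP := iw.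
pose W := (\int[lam d]_t `|(w t)%:E|)%E.
have WE : W = (fine W)%:E.
  rewrite fineK// ge0_fin_numE; last exact: integral_ge0.
  by case/integrableP : iw.
have W0 : 0 <= fine W by apply: fine_ge0; exact: integral_ge0.
have fleW x : f x <= fine W.
  have [xn|xn] := pselect (no_zero_coord x); last by rewrite f0.
  rewrite -lee_fin -WE (fw x xn); apply: le_trans (lee_abs _) _.
  apply: le_trans (le_abse_integral _ _ _) _ => //.
    apply/measurable_EFinP; apply: measurable_funM => //.
    exact: measurable_indic_symbox.
  apply: ge0_le_integralT => t //.
  rewrite !abse_EFin lee_fin normrM -[leRHS]mul1r ler_wpM2r//.
  exact: normr_indic_le1.
exists (fine W), ((2 * Num.max 1 T) ^+ d * fine W); split.
  split => // [x|x fx k]; first by rewrite fge0/=.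
  have xn : no_zero_coord x by apply: contrapT => /f0; apply/eqP.
  apply: contraNT fx; rewrite -ltNge => Tx; apply/eqP/EFin_inj.
  rewrite (fw x xn) integral0_eq// => t _; congr EFin.
  have [->|wt] := eqVneq (w t) 0; first by rewrite mulr0.
  rewrite indicE memNset ?mul0r// => /(_ k) xt.
  have /andP[_ tT] := wT t wt k.
  by move: (lt_le_trans Tx (le_trans xt tT)); rewrite ltxx.
move=> theta xi xi0.
have := tail_fourier_le iw wT mf fw theta xi0.
rewrite -/W WE -EFinM mulrAC => H.
have fin : (\int[lam d]_x (f x * cos (theta + dot x xi))%:E)%E \is a fin_num.
  rewrite -abse_fin_num fin_numElt (le_lt_trans H (ltry _)) andbT.
  by rewrite (lt_le_trans _ (abse_ge0 _)).
by rewrite -lee_fin -abse_EFin /Rintegral (fineK fin); exact: H.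
Qed.

Lemma orthantE d : @orthant R d =
  [set x | forall k, (`]0, +oo[%classic : set (measurableTypeR R)) (tnth x k)].
Proof.
by apply/seteqP; split => x xo k; have := xo k; rewrite /= in_itv/= andbT.
Qed.

Lemma measurable_orthant d : measurable (@orthant R d).
Proof.
rewrite orthantE; apply: (measurable_coordwise (A := fun=> `]0, +oo[%classic)) => k.
exact: measurable_itv.
Qed.

Lemma upper_quadrant_orthant d (y : Rtuple R d) : orthant y ->
  upper_quadrant y `<=` @orthant R d.
Proof. by move=> yo t yt k; exact: lt_le_trans (yo k) (yt k). Qed.

Lemma tail_integralE d (w : Rtuple R d -> R) (x : Rtuple R d) :
  (lam d).-integrable (@orthant R d) (EFin \o w) -> no_zero_coord x ->
  ((tail_integral w (abs_tuple x))%:E =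
   \int[lam d]_t (\1_(symbox (tnth t)) x * (w t * \1_(@orthant R d) t))%:E)%E.
Proof.
move=> iw xn; have xo := orthant_abs_tuple xn.
have sub := upper_quadrant_orthant xo.
have iwq : (lam d).-integrable (upper_quadrant (abs_tuple x)) (EFin \o w).
  apply: integrableS iw => //; first exact: measurable_orthant.
  exact: measurable_upper_quadrant.
rewrite /tail_integral /Rintegral fineK; last first.
  by apply: integrable_fin_num => //; exact: measurable_upper_quadrant.
rewrite integral_mkcond; apply: eq_integral => t _; rewrite patchE.
case: ifPn => [|]; rewrite ?inE ?notin_setE => tq.
  rewrite !indicE !mem_set ?mul1r ?mulr1//; first exact: sub.
  exact/upper_quadrant_abs_tuple.
rewrite indicE memNset ?mul0r// => /upper_quadrant_abs_tuple; exact: tq.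
Qed.

Lemma compactly_supported_bounded d (w : Rtuple R d -> R) :
  compactly_supported w ->
  exists2 T, 0 <= T & forall t, orthant t -> w t != 0 -> forall k, tnth t k <= T.
Proof.
move=> cw.
have bnd k : exists T, forall t, orthant t -> w t != 0 -> tnth t k <= T.
  have ck : {within _, continuous (fun v : 'rV[R]_d => v ord0 k)} :=
    continuous_subspaceT (@coord_continuous _ _ _ ord0 k).
  have /compact_bounded [M [_ /(_ (M + 1))]] := continuous_compact (ck _) cw.
  rewrite ltrDl ltr01 => /(_ isT) H; exists (M + 1) => t to wt.
  apply: le_trans (ler_norm _) _; apply: H => /=.
  exists (\row_k tnth t k); last by rewrite mxE.
  by apply: subset_closure => /=; exists t.
have /choice[Tk TkP] := bnd.
exists (\sum_k `|Tk k|); first by apply: sumr_ge0.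
move=> t to wt k; apply: le_trans (TkP k t to wt) _.
by apply: le_trans (ler_norm _) _; rewrite (bigD1 k)//= lerDl sumr_ge0.
Qed.

Lemma tail_integral_profile d (g f : Rtuple R d -> R) :
  is_tail_integral g -> even_extension g f ->
  exists M T r delta C, profile (off_hyperplanes f) M T r delta /\
    fourier_decay (off_hyperplanes f) C.
Proof.
move=> [w [w0 wnz iw cw gw]] [mf fE].
have [T T0 wT] := compactly_supported_bounded cw.
(* Outside the orthant w is unconstrained, so it is cut off there. *)
pose wo t := w t * \1_(@orthant R d) t.
have woE : EFin \o wo = (EFin \o w) \_ (@orthant R d).
  apply/funext => t; rewrite patchE /wo /= indicE.
  by case: (t \in _); rewrite ?mulr1 ?mulr0.
have iwo : (lam d).-integrable setT (EFin \o wo).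
  by rewrite woE; apply/(integrable_mkcond _ (@measurable_orthant d)).
have mw : measurable_fun (@orthant R d) (EFin \o w) := measurable_int _ iw.
have fw x : no_zero_coord x -> ((off_hyperplanes f x)%:E =
    \int[lam d]_t (\1_(symbox (tnth t)) x * wo t)%:E)%E.
  move=> xn; rewrite off_hyperplanesE// fE// gw; last exact: orthant_abs_tuple.
  exact: tail_integralE.
have wo0 t : 0 <= wo t.
  rewrite /wo indicE; case: (boolP (t \in _)) => [|_]; last by rewrite mulr0.
  by rewrite inE mulr1; exact: w0.
(* The quadrants from (1/(n+1), ..., 1/(n+1)) exhaust the orthant, so one of
   them has positive mass. This mass bounds f below at the points x with
   |x_k| <= 1/(n+1), whose quadrants are larger. *)
pose y n : Rtuple R d := [tuple n.+1%:R^-1 | k < d].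
have yo n : orthant (y n) by move=> k; rewrite tnth_mktuple invr_gt0.
pose F n := upper_quadrant (y n).
have mF n : measurable (F n) by exact: measurable_upper_quadrant.
have FU : \bigcup_n F n = @orthant R d.
  apply/seteqP; split => t; first by move=> [n _]; exact: upper_quadrant_orthant.
  move=> to; have [r r0 rt] := common_lower_bound to.
  exists (Num.truncn r^-1) => // k; rewrite tnth_mktuple; apply: le_trans (rt k).
  rewrite -[leRHS]invrK lef_pV2 ?posrE ?invr_gt0//.
  by apply/ltW/truncnS_gt.
have ndF : nondecreasing_seq F.
  move=> m n mn; rewrite subsetEset => t tm k.
  apply: le_trans (tm k); rewrite !tnth_mktuple lef_pV2 ?posrE//.
  by rewrite ler_nat.
have w0F n t : F n t -> (0 <= (w t)%:E)%E.
  by move=> Ft; rewrite lee_fin; apply: w0; exact: upper_quadrant_orthant Ft.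
have cvgF : (\int[lam d]_(t in F n) (w t)%:E @[n --> \oo] -->
    \int[lam d]_(t in \bigcup_n F n) (w t)%:E)%E.
  apply: (@ge0_nondecreasing_set_cvg_integral _ _ R F) => //.
  move=> n; apply: measurable_funS mw; first exact: measurable_orthant.
  exact: upper_quadrant_orthant.
have [n wn] : exists n, (0 < \int[lam d]_(t in F n) (w t)%:E)%E.
  apply: contrapT => /forallNP wn; apply: wnz.
  have I0 : (\int[lam d]_(t in @orthant R d) `|(w t)%:E|)%E = 0%E.
    transitivity (\int[lam d]_(t in @orthant R d) (w t)%:E)%E.
      apply: eq_integral => t; rewrite inE => to.
      by rewrite gee0_abs// lee_fin w0.
    rewrite -FU -(cvg_lim _ cvgF)//.
    apply: lim_near_cst => //; apply: nearW => n.
    apply/eqP; rewrite eq_le integral_ge0 ?andbT; last by move=> t /w0F.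
    by rewrite leNgt; apply/negP; exact: wn.
  have /(ae_eq_integral_abs _ (@measurable_orthant d) mw) := I0.
  by apply: filterS => t tw to; have [] := tw to.
have yE x : no_zero_coord x -> (forall k, `|tnth x k| <= n.+1%:R^-1) ->
    \int[lam d]_(t in F n) w t <= off_hyperplanes f x.
  move=> xn xr; rewrite off_hyperplanesE// fE// gw; last exact: orthant_abs_tuple.
  have sub : F n `<=` upper_quadrant (abs_tuple x).
    move=> t tF k; rewrite tnth_mktuple; apply: le_trans (xr k) _.
    by have := tF k; rewrite tnth_mktuple.
  have so := upper_quadrant_orthant (orthant_abs_tuple xn).
  have mq := measurable_upper_quadrant (abs_tuple x).
  have iq : (lam d).-integrable (upper_quadrant (abs_tuple x)) (EFin \o w).
    by apply: integrableS iw => //; exact: measurable_orthant.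
  apply: fine_le.
  - by apply: integrable_fin_num => //; apply: integrableS iq.
  - exact: integrable_fin_num.
  - apply: ge0_subset_integral => //; first exact: measurable_int iq.
    by move=> t tq; rewrite lee_fin; apply/w0/so.
suff [M [C H]] : exists M C,
    profile (off_hyperplanes f) M T n.+1%:R^-1 (\int[lam d]_(t in F n) w t) /\
    fourier_decay (off_hyperplanes f) C.
  by exists M, T, n.+1%:R^-1, (\int[lam d]_(t in F n) w t), C.
apply: (tail_profile iwo) => //.
- move=> t; rewrite /wo indicE; case: (boolP (t \in _)) => [|_]; last first.
    by rewrite mulr0 eqxx.
  by rewrite inE mulr1 => to wt k; rewrite (to k) (wT t to wt k).
- exact: measurable_off_hyperplanes.
- by move=> x; exact: off_hyperplanes0.
- move=> x; have [xn|xn] := pselect (no_zero_coord x).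
    rewrite -lee_fin fw//; apply: integral_ge0 => t _.
    by rewrite lee_fin mulr_ge0.
  by rewrite off_hyperplanes0.
- move=> x xr; apply: yE; first exact: no_zero_coord_pos xr.
  by move=> k; have /andP[x0 xk] := xr k; rewrite gtr0_norm.
- apply: fine_gt0; rewrite wn/=.
  have : (lam d).-integrable (F n) (EFin \o w).
    apply: integrableS iw => //; first exact: measurable_orthant.
    exact: upper_quadrant_orthant.
  by move=> /(integrable_fin_num (mF n)); rewrite fin_numElt => /andP[].
Qed.

End TailExample.

(** * Differences of translated product densities *)

Section SmoothExample.
Variable R : realType.
Local Notation leb := (@lebesgue_measure R).
Local Notation lam := (lebesgue_tuple R).

Lemma integral_prod_coord d (h : 'I_d -> measurableTypeR R -> R) :
  (forall k x, 0 <= h k x) -> (forall k, measurable_fun setT (h k)) ->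
  (\int[lam d]_t (\prod_k h k (tnth t k))%:E = \prod_k \int[leb]_s (h k s)%:E)%E.
Proof.
elim: d h => [|d IH] h h0 mh.
  rewrite big_ord0 [LHS](@integral_dirac _ _ _ R)//; last first.
    by under eq_fun do rewrite big_ord0; exact: measurable_cst.
  by rewrite diracT mul1e big_ord0.
have mH n (h' : 'I_n -> measurableTypeR R -> R) :
    (forall k, measurable_fun setT (h' k)) ->
    measurable_fun setT (fun t : Rtuple R n => (\prod_k h' k (tnth t k))%:E).
  move=> mh'; apply/measurable_EFinP; apply: measurable_prod => k _.
  by apply: (measurableT_comp (mh' k)); exact: measurable_tnth.
rewrite [LHS](@ge0_integral_pushforward _ _ _ _ _ _ (@measurable_tcons _ _ d)
    (leb \x lam d)%E setT (fun t => (\prod_k h k (tnth t k))%:E))//; last 2 first.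
- exact: mH.
- by move=> t _; rewrite lee_fin prodr_ge0.
rewrite preimage_setT fubini_tonelli1//; last 2 first.
- by apply: measurableT_comp; [exact: mH|exact: measurable_tcons].
- by move=> t; rewrite /= lee_fin prodr_ge0.
pose h' k := h (lift ord0 k).
have step x : (\int[lam d]_t ((fun t => (\prod_k h k (tnth t k))%:E) \o
      @tcons _ (measurableTypeR R) d) (x, t) =
    (h ord0 x)%:E * \prod_k \int[leb]_s (h' k s)%:E)%E.
  rewrite -IH; last 2 first.
  - by move=> k y; exact: h0.
  - by move=> k; exact: mh.
  rewrite -ge0_integralZl//; last 3 first.
  - by apply: mH => k; exact: mh.
  - by move=> t _; rewrite lee_fin prodr_ge0// => k _; exact: h0.
  - by rewrite lee_fin.
  apply: eq_integral => t _; rewrite /= big_ord_recl -EFinM; congr EFin.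
  by congr (_ * _); apply: eq_bigr => k _; rewrite /tcons tnthS.
rewrite /fubini_F; under eq_integral do rewrite step muleC.
rewrite ge0_integralZl//; last 3 first.
- by apply/measurable_EFinP; exact: mh.
- by move=> x _; rewrite lee_fin.
- elim/big_ind : _ => // [x y|k _]; first exact: mule_ge0.
  by apply: integral_ge0 => s _; rewrite lee_fin h0.
by rewrite big_ord_recl muleC.
Qed.

Lemma smooth_continuous (h : R -> R) : smooth h -> continuous h.
Proof.
move=> sh z; apply: differentiable_continuous; apply/derivable1_diffP.
exact: (sh 0%N z).
Qed.

Lemma test_function_support (e : R) (h : R -> R) z :
  test_function `]0, e[ h -> h z != 0 -> 0 < z < e.
Proof.
move=> [_ _ sub] hz.
have /sub : closure [set y | h y != 0] z by exact: subset_closure.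
by rewrite /= in_itv.
Qed.

Lemma test_function_bounded (e : R) (h : R -> R) :
  test_function `]0, e[ h -> exists B, forall z, `|h z| <= B.
Proof.
move=> th; have [sh _ _] := th.
have ch : {within `[0, e], continuous h}.
  by apply: continuous_subspaceT; exact: smooth_continuous.
have /compact_bounded [M [_ /(_ (`|M| + 1))]] :=
  continuous_compact ch (@segment_compact R 0 e).
rewrite (le_lt_trans (ler_norm _)) ?ltrDl// => /(_ isT) H.
exists (`|M| + 1) => z.
have [->|hz] := eqVneq (h z) 0; first by rewrite normr0 addr_ge0.
apply: H => /=; exists z => //.
have /andP[z0 ze] := test_function_support th hz.
by rewrite /= in_itv/= !ltW.
Qed.

Lemma ge0_integral_shift (h : R -> R) (x v : R) : continuous h ->
  (forall z, 0 <= h z) ->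
  (\int[leb]_(s in `[x, +oo[) (h (s - v))%:E =
   \int[leb]_(s in `[(x - v)%R, +oo[) (h s)%:E)%E.
Proof.
move=> ch h0; pose F (s : R) : R := s - v.
have dF (s : R) : is_derive s 1 F 1.
  have dA := is_deriveD (is_derive_id s 1) (is_derive_cst (- v) s 1).
  by apply: is_derive_eq dA _; rewrite addr0.
have F' : F^`()%classic = cst 1.
  by apply/funext => s; rewrite derive1E; apply: derive_val.
rewrite (@increasing_ge0_integration_by_substitutiony R F h x).
- by apply: eq_integral => s _; rewrite F' /= mulr1.
- by move=> s t _ _ st; rewrite /F ltrD2r.
- by rewrite F' => s _; exact: cst_continuous.
- by rewrite F'; apply: is_cvg_cst.
- by rewrite F'; apply: is_cvg_cst.
- split; first by move=> s _; exact: (@ex_derive _ _ _ _ _ _ _ (dF s)).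
  apply: cvg_at_right_filter; apply: differentiable_continuous.
  by apply/derivable1_diffP; exact: (@ex_derive _ _ _ _ _ _ _ (dF x)).
- exact: cvg_addrr.
- exact: continuous_subspaceT.
- by move=> s _.
Qed.

Lemma continuous_integral_gt0 (h : R -> R) (z : R) : continuous h ->
  (forall z, 0 <= h z) -> 0 < z -> 0 < h z ->
  (0 < \int[leb]_(s in `[0%R, +oo[) (h s)%:E)%E.
Proof.
move=> ch h0 z0 hz.
have : \forall s \near z, h z / 2 < h s.
  have := ch z; rewrite /continuous_at => /cvgr_gt; apply.
  by rewrite ltr_pdivrMr// ltr_pMr// ltr1n.
move=> /nbhs_ballP[e /= e0 eP].
apply: (@lt_le_trans _ _ (\int[leb]_(s in `[z, (z + e / 2)%R]) (h z / 2)%:E)%E).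
  rewrite integral_cst//= lebesgue_measure_itv/= lte_fin ltrDl divr_gt0//.
  by rewrite -EFinB -EFinM lte_fin mulr_gt0 ?divr_gt0// addrC addKr divr_gt0.
have mh (D : set R) : measurable_fun D (fun s => (h s)%:E).
  by apply: measurable_funTS; apply/measurable_EFinP; exact: continuous_measurable_fun.
apply: (@le_trans _ _ (\int[leb]_(s in `[z, (z + e / 2)%R]) (h s)%:E)%E).
  apply: ge0_le_integral => //.
  - by move=> s _; rewrite lee_fin divr_ge0// ltW.
  - exact: mh.
  move=> s; rewrite /= in_itv/= => /andP[zs sz]; rewrite lee_fin ltW//; apply: eP.
  rewrite /ball/= distrC ger0_norm ?subr_ge0// ltrBlDl.
  by apply: le_lt_trans sz _; rewrite ltrD2l ltr_pdivrMr// ltr_pMr// ltr1n.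
apply: ge0_subset_integral => //; first exact: mh.
  by move=> s _; rewrite lee_fin.
by move=> s; rewrite /= !in_itv/= andbT => /andP[zs _]; exact: le_trans (ltW z0) zs.
Qed.

Definition truncated_shift (phi : R -> R) (v x : R) (s : measurableTypeR R) : R :=
  \1_(`[x, +oo[%classic : set (measurableTypeR R)) s * phi (s - v).

Lemma integral_truncated_shiftE (phi : R -> R) (v x : R) : continuous phi ->
  (forall z, 0 <= phi z) ->
  (\int[leb]_s (truncated_shift phi v x s)%:E =
   \int[leb]_(s in `[(x - v)%R, +oo[) (phi s)%:E)%E.
Proof.
move=> cphi phi0; rewrite -ge0_integral_shift// [RHS]integral_mkcond.
apply: eq_integral => s _; rewrite patchE /truncated_shift indicE.
by case: (s \in _); rewrite ?mul1r ?mul0r.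
Qed.

Lemma measurable_truncated_shift (phi : R -> R) (v x : R) : continuous phi ->
  measurable_fun setT (truncated_shift phi v x).
Proof.
move=> cphi; apply: measurable_funM.
  by apply: measurable_indic; exact: measurable_itv.
apply: continuous_measurable_fun => s.
apply: (@continuous_comp _ _ _ (fun s => s - v) phi).
  by apply: cvgB; [exact: cvg_id|exact: cvg_cst].
exact: cphi.
Qed.

Lemma le_integral_truncated_shift (phi : R -> R) (v x v' x' : R) :
  continuous phi -> (forall z, 0 <= phi z) -> x' - v' <= x - v ->
  (\int[leb]_s (truncated_shift phi v x s)%:E <=
   \int[leb]_s (truncated_shift phi v' x' s)%:E)%E.
Proof.
move=> cphi phi0 xv; rewrite !integral_truncated_shiftE//.
apply: ge0_subset_integral => //.
- by apply: measurable_funTS; apply/measurable_EFinP; exact: continuous_measurable_fun.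
- by move=> s _; rewrite lee_fin.
- by move=> s; rewrite /= !in_itv/= !andbT; exact: le_trans.
Qed.

Section TranslatedDensity.
Variables (d : nat) (phi : 'I_d -> R -> R) (e : R).
Hypothesis phiP : forall k,
  test_function `]0, e[ (phi k) /\ forall z, 0 <= phi k z.

Let cphi k : continuous (phi k).
Proof. by have [[sm _ _] _] := phiP k; exact: smooth_continuous. Qed.

Let phi0 k z : 0 <= phi k z. Proof. by have [_] := phiP k. Qed.

Lemma translated_density_ge0 v t : 0 <= translated_density phi v t.
Proof. by apply: prodr_ge0 => k _. Qed.

Lemma translated_density_support (v t : Rtuple R d) :
  translated_density phi v t != 0 ->
  forall k, tnth v k < tnth t k < tnth v k + e.
Proof.
move=> pt k; have /test_function_support : phi k (tnth t k - tnth v k) != 0.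
  by apply: contraNneq pt => pk; rewrite /translated_density (bigD1 k)//= pk mul0r.
have [tf _] := phiP k => /(_ _ tf).
by rewrite subr_gt0 ltrBlDl.
Qed.

Lemma integrable_translated_density (v : Rtuple R d) :
  (lam d).-integrable setT (EFin \o translated_density phi v).
Proof.
have /choice[B BP] : forall k, exists B, forall z, `|phi k z| <= B.
  by move=> k; have [tf _] := phiP k; exact: test_function_bounded tf.
apply: (@integrable_symbox _ _ (fun k => `|tnth v k| + `|e|) _ (\prod_k B k)).
- apply: measurable_prod => k _.
  apply: (@measurableT_comp _ _ _ _ _ _ (phi k)).
    by apply: continuous_measurable_fun; exact: cphi.
  by apply: measurable_funB => //; exact: measurable_tnth.
- by move=> t; rewrite normr_prod; apply: ler_prod => k _; rewrite normr_ge0/=.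
- move=> t ns; apply/eqP/negPn/negP => /translated_density_support pt.
  apply: ns => k; have /andP[h1 h2] := pt k; rewrite ler_norml.
  have := ler_norm (tnth v k); have := ler_norm (- tnth v k); rewrite normrN.
  have := ler_norm e; have := normr_ge0 e.
  by move=> ? ? ? ?; apply/andP; split; lra.
Qed.

(** In product form the mass of a quadrant is monotone in the position of the
   density, one coordinate at a time; this is how b is compared with a. *)
Lemma integral_translated_density (v x : Rtuple R d) :
  (\int[lam d]_t (\1_(symbox (tnth t)) x * translated_density phi v t)%:E =
   \prod_k \int[leb]_s (truncated_shift (phi k) (tnth v k) `|tnth x k| s)%:E)%E.
Proof.
rewrite -(integral_prod_coord
  (h := fun k => truncated_shift (phi k) (tnth v k) `|tnth x k|)).
- apply: eq_integral => t _; congr EFin; rewrite /truncated_shift big_split/=.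
  have [xt|xt] := pselect (symbox (tnth t) x).
    rewrite indicE mem_set// mul1r big1 ?mul1r// => k _.
    by rewrite indicE mem_set//= in_itv/= andbT; exact: xt.
  rewrite indicE memNset// mul0r.
  have /existsNP[k /negP xk] := xt.
  rewrite (bigD1 k)//= indicE memNset ?mul0r//= in_itv/= andbT.
  exact/negP.
- by move=> k s; rewrite /truncated_shift mulr_ge0.
- by move=> k; exact: measurable_truncated_shift.
Qed.

Lemma integrable_symbox_translated_density (v x : Rtuple R d) :
  (lam d).-integrable setT
    (fun t => (\1_(symbox (tnth t)) x * translated_density phi v t)%:E).
Proof.
have iv := integrable_translated_density v.
apply: le_integrable iv => //.
  apply/measurable_EFinP; apply: measurable_funM; last first.
    by have /measurable_int/measurable_EFinP := integrable_translated_density v.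
  exact: measurable_indic_symbox.
move=> t _; rewrite !abse_EFin lee_fin normrM -[leRHS]mul1r ler_wpM2r//.
exact: normr_indic_le1.
Qed.

Lemma translated_measureE (v x : Rtuple R d) :
  translated_measure phi v (upper_quadrant (abs_tuple x)) =
  (\int[lam d]_t (\1_(symbox (tnth t)) x * translated_density phi v t)%:E)%E.
Proof.
rewrite /translated_measure integral_mkcond; apply: eq_integral => t _.
rewrite patchE indicE; case: ifPn; rewrite ?inE ?notin_setE => tq.
  by rewrite mem_set ?mul1r//; exact/upper_quadrant_abs_tuple.
by rewrite memNset ?mul0r// => /upper_quadrant_abs_tuple; exact: tq.
Qed.

End TranslatedDensity.

(** For every x the quadrant t >= |x| holds at least as much of the mass around b
   as of the mass around a, because b lies further out. Hence f is at least
   1 - c times the former, which gives nonnegativity; and for x below b the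
   quadrant holds at least as much of that mass as the quadrant t >= b, which
   contains all of it. *)
Lemma smooth_difference_profile d (g f : Rtuple R d -> R) :
  is_smooth_difference g -> even_extension g f ->
  exists M T r delta C, profile (off_hyperplanes f) M T r delta /\
    fourier_decay (off_hyperplanes f) C.
Proof.
move=> [_ [a [b [c [e [phi [[/andP[c0 c1] e0] [ao bo abe] phiP]]]]]]].
move=> [z0 z0P] gE [mf fE].
have cphi k : continuous (phi k).
  by have [[sm _ _] _] := phiP k; exact: smooth_continuous.
have phi0 k z : 0 <= phi k z by have [_] := phiP k.
have ab k : tnth a k <= tnth b k by have := abe k; lra.
pose N v (x : Rtuple R d) := \int[lam d]_t
  (\1_(symbox (tnth t)) x * translated_density phi v t).
have NE v x : (N v x)%:E =
    (\int[lam d]_t (\1_(symbox (tnth t)) x * translated_density phi v t)%:E)%E.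
  rewrite /N /Rintegral fineK//; apply: integrable_fin_num => //.
  exact: integrable_symbox_translated_density phiP v x.
have fN x : no_zero_coord x -> off_hyperplanes f x = N b x - c * N a x.
  move=> xn; rewrite off_hyperplanesE// fE// gE; last exact: orthant_abs_tuple.
  by rewrite !translated_measureE -!NE -EFinM -EFinB.
have shift_ge0 v x k : (0 <= \int[leb]_s (truncated_shift (phi k) v x s)%:E)%E.
  by apply: integral_ge0 => s _; rewrite lee_fin /truncated_shift mulr_ge0.
have Nle v v' (x x' : Rtuple R d) :
    (forall k, `|tnth x' k| - tnth v' k <= `|tnth x k| - tnth v k) ->
    N v x <= N v' x'.
  move=> H; rewrite -lee_fin !NE !(integral_translated_density phiP).
  set F := fun k =>
    (\int[leb]_s (truncated_shift (phi k) (tnth v k) `|tnth x k| s)%:E)%E.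
  set F' := fun k =>
    (\int[leb]_s (truncated_shift (phi k) (tnth v' k) `|tnth x' k| s)%:E)%E.
  suff /andP[] : (0 <= \prod_k F k <= \prod_k F' k)%E by [].
  elim/big_ind2 : _ => [|u1 u2 v1 v2 /andP[? ?] /andP[? ?]|k _].
  - by rewrite lee_fin ler01 lexx.
  - by rewrite mule_ge0//= lee_pmul.
  - by rewrite /F shift_ge0/=; exact: le_integral_truncated_shift.
have N0 v x : 0 <= N v x.
  apply: Rintegral_ge0 => t _; rewrite mulr_ge0//.
  exact: translated_density_ge0 phiP _ _.
have gap x : no_zero_coord x -> (1 - c) * N b x <= off_hyperplanes f x.
  move=> xn; rewrite fN// mulrBl mul1r lerD2l lerN2 ler_pM2l//.
  by apply: Nle => k; rewrite lerD2l lerN2.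
have [r r0 rb] := common_lower_bound bo.
have Nb0 : 0 < N b b.
  rewrite -lte_fin NE (integral_translated_density phiP).
  elim/big_ind : _ => [|u v|k _]; [by rewrite lte_fin|exact: mule_gt0|].
  rewrite integral_truncated_shiftE// gtr0_norm; last exact: bo.
  rewrite subrr.
  have zk : phi k (tnth z0 k) != 0.
    by apply: contraNneq z0P => pk; rewrite (bigD1 k)//= pk mul0r.
  apply: (continuous_integral_gt0 (h := phi k) (z := tnth z0 k)) => //.
    by have [tf _] := phiP k; have /andP[] := test_function_support tf zk.
  by rewrite lt_neqAle eq_sym zk phi0.
have bound k : 0 < tnth b k + e by rewrite addr_gt0//; exact: bo.
have [T T0 bT] := common_upper_bound bound.
pose w t := translated_density phi b t - c * translated_density phi a t.
have iw : (lam d).-integrable setT (EFin \o w).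
  have := integrableB measurableT (integrable_translated_density phiP b)
    (integrableZl measurableT c (integrable_translated_density phiP a)).
  by [].
suff [M [C H]] : exists M C,
    profile (off_hyperplanes f) M T r ((1 - c) * N b b) /\
    fourier_decay (off_hyperplanes f) C.
  by exists M, T, r, ((1 - c) * N b b), C.
apply: (tail_profile iw) => //.
- move=> t wt k.
  have [bt|bt] := eqVneq (translated_density phi b t) 0.
    have at0 : translated_density phi a t != 0.
      by apply: contraNneq wt => at0; rewrite /w bt at0 mulr0 subrr.
    have /andP[h1 h2] := translated_density_support phiP at0 k.
    rewrite (lt_trans (ao k))//=; apply: le_trans (bT k).
    by apply: le_trans (ltW h2) _; rewrite lerD2r.
  have /andP[h1 h2] := translated_density_support phiP bt k.
  by rewrite (lt_trans (bo k))//= (le_trans (ltW h2)).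
- exact: measurable_off_hyperplanes.
- by move=> x; exact: off_hyperplanes0.
- move=> x xn; rewrite fN// EFinB EFinM !NE.
  rewrite -integralZl//; last exact: integrable_symbox_translated_density phiP a x.
  rewrite -integralB//; last 2 first.
  + exact: integrable_symbox_translated_density phiP b x.
  + apply: integrableZl => //.
    exact: integrable_symbox_translated_density phiP a x.
  apply: eq_integral => t _; rewrite -EFinM -EFinB; congr EFin.
  by rewrite /w mulrBr mulrCA.
- move=> x; have [xn|xn] := pselect (no_zero_coord x); last by rewrite off_hyperplanes0.
  by apply: le_trans (gap x xn); rewrite mulr_ge0// subr_ge0 ltW.
- move=> x xr; have xn := no_zero_coord_pos xr; apply: le_trans (gap x xn).
  rewrite ler_pM2l ?subr_gt0//; apply: Nle => k; rewrite lerD2r.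
  have /andP[x0 xk] := xr k.
  by rewrite (gtr0_norm x0) gtr0_norm ?(le_trans xk)//; exact: bo.
- by rewrite mulr_gt0// subr_gt0.
Qed.

End SmoothExample.

(** * The two norms of f *)

Theorem corollary5p7 (R : realType) (d : nat) (p q alpha beta : 'I_d -> R)
    (g f : Rtuple R d -> R) :
  (1 <= d)%N ->
  (forall k, 1 <= p k <= q k) ->
  (forall k, beta k = 1 - 1 / p k - 1 / q k - alpha k) ->
  is_tail_integral g \/ is_box_difference g \/ is_smooth_difference g ->
  even_extension g f ->
  [/\ (fourier_norm alpha q f < +oo)%E /\ (spatial_norm beta p f < +oo)%E <->
      (forall k, - (1 / q k) < alpha k < 1 - 1 / q k),
      (exists k, alpha k = - (1 / q k)) -> fourier_norm alpha q f = +oo%E &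
      (exists k, alpha k = 1 - 1 / q k) -> spatial_norm beta p f = +oo%E].
Proof.
move=> _ pq betaE gP fg; have [mf _] := fg.
have p1 k : 1 <= p k by have /andP[] := pq k.
have p0 k : 0 < p k by exact: lt_le_trans (p1 k).
have q0 k : 0 < q k by have /andP[_] := pq k; exact: lt_le_trans.
pose f0 := off_hyperplanes f.
have fourierE : fourier_norm alpha q f = fourier_norm alpha q f0.
  rewrite /fourier_norm (abel_fourier_ext (f' := f0))//.
    exact: measurable_off_hyperplanes.
  by move=> x xn; rewrite /f0 off_hyperplanesE.
have spatialE : spatial_norm beta p f = spatial_norm beta p f0.
  congr mixed_norm; apply/funext => x.
  have [xn|xn] := pselect (no_zero_coord x); first by rewrite /f0 off_hyperplanesE.
  by rewrite (weight_zero _ xn) !mul0r.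
have [M [T [r [delta [C [pf dc]]]]]] : exists M T r delta C,
    profile f0 M T r delta /\ fourier_decay f0 C.
  case: gP => [|[|]] gP; first exact: tail_integral_profile gP fg.
    exact: box_difference_profile gP fg.
  exact: smooth_difference_profile gP fg.
have low : (exists k, alpha k <= - (1 / q k)) -> fourier_norm alpha q f = +oo%E.
  by move=> H; rewrite fourierE; exact: fourier_norm_infty pf q0 H.
have high : (exists k, 1 - 1 / q k <= alpha k) -> spatial_norm beta p f = +oo%E.
  move=> [k H]; rewrite spatialE; apply: (spatial_norm_infty pf p0).
  by exists k; rewrite betaE; lra.
split.
- split=> [[Ffin Sfin] k|aq].
    apply/andP; split; rewrite ltNge; apply/negP => H.
      have Foo : fourier_norm alpha q f = +oo%E by apply: low; exists k.
      by move: Ffin; rewrite Foo ltxx.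
    have Soo : spatial_norm beta p f = +oo%E by apply: high; exists k.
    by move: Sfin; rewrite Soo ltxx.
  rewrite fourierE spatialE; split; first exact: fourier_norm_lty pf dc q0 aq.
  apply: (spatial_norm_lty pf p1) => k.
  by have /andP[_] := aq k; rewrite betaE; lra.
- by move=> [k H]; apply: low; exists k; rewrite H.
- by move=> [k H]; apply: high; exists k; rewrite H.
Qed.
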